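(* Let $\mathcal H$ be a complex Hilbert space, $m\ge1$, let $R_0,\dots,R_m$ be Hermitian trace class operators and $E$ an orthogonal projection with $R_iE=R_i$ for all $i=0,\dots,m$. Put $$\varkappa^{\mathrm o}(R)=\sup\Big\{\sum_{i=0}^m\operatorname{Tr}(R_iD_i):D_i\ge0,\ \sum_{i=0}^mD_i=E\Big\},$$ $$\langle R\rangle_+=\inf\{\operatorname{Tr}(LE):L\ \text{Hermitian trace class},\ L\ge R_i,\ i=0,\dots,m\}.$$ (i) Operators $D_i^{\mathrm o}\ge0$, $i=0,\dots,m$, with $\sum_{i=0}^mD_i^{\mathrm o}=E$ attain the supremum $\varkappa^{\mathrm o}(R)$ if and only if there is a trace class operator $L^{\mathrm o}$ with $L^{\mathrm o}\ge R_i$ for $i=0,\dots,m$ and $$(L^{\mathrm o}-R_i)D_i^{\mathrm o}=0,\qquad i=0,\dots,m.$$ (ii) The operator $L^{\mathrm o}$ is then a solution of the dual problem, i.e. attains the infimum $\langle R\rangle_+$; for the dual problem the equations in (i), with $D_i^{\mathrm o}\ge0$ and $\sum_{i=0}^mD_i^{\mathrm o}=E$, are also necessary and sufficient (a trace class $L^{\mathrm o}$ with $L^{\mathrm o}\ge R_i$ for all $i$ attains the infimum if and only if such $D_i^{\mathrm o}$ exist). Moreover $\varkappa^{\mathrm o}(R)=\langle R\rangle_+$. (iii) Let $C_1,\dots,C_m$ be Hermitian trace class operators with $C_iE=C_i$, let $\varepsilon_1,\dots,\varepsilon_m$ be given real levels, and consider the constrained extremal problem $$\tau^{\mathrm o}(\mathbf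 C)=\inf\Big\{\sum_{i=1}^m\operatorname{Tr}\Big(C_i\sum_{1\le k\le m,\,k\ne i}D_k\Big):D_i\ge0,\ \sum_{i=1}^mD_i\le E,\ \operatorname{Tr}(C_iD_i)\ge\varepsilon_i,\ i=1,\dots,m\Big\}.$$ For $\lambda=(\lambda_1,\dots,\lambda_m)$ with $\lambda_i\ge0$ put $R_0^\lambda=\sum_{i=1}^mC_i$ and $R_i^\lambda=(1+\lambda_i)C_i$, $i=1,\dots,m$. The solution $L^{\mathrm o}$ of the dual problem in (ii) for the operators $R_i=R_i^{\lambda}$, $i=0,\dots,m$, taken at $\lambda=\lambda^{\mathrm o}$, represents the solution of this constrained problem in the Lagrange form $$\tau^{\mathrm o}(\mathbf C)=\sum_{i=1}^m\big(\operatorname{Tr}(C_iE)+\lambda_i^{\mathrm o}\varepsilon_i\big)-\operatorname{Tr}(L^{\mathrm o}E),$$ where the parameters $\lambda_i^{\mathrm o}\ge0$ are to be found from the conditions $$\lambda_i^{\mathrm o}\big(\varepsilon_i-\operatorname{Tr}(C_iD_i^{\mathrm o})\big)=0,\qquad \varepsilon_i\le\operatorname{Tr}(C_iD_i^{\mathrm o}),\qquad i=1,\dots,m,$$ with $D_0^{\mathrm o},\dots,D_m^{\mathrm o}$ the corresponding optimal operators of (i) for $R_i=R_i^{\lambda^{\mathrm o}}$. That is, the constrained optimum is given by this formula with multipliers $\lambda_i^{\mathrm o}\ge0$ satisfying these conditions.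
   Context: Operators are bounded linear operators on $\mathcal H$; $A\ge B$ means that $A-B$ is Hermitian positive semidefinite; $\operatorname{Tr}$ is the trace on $\mathcal H$.
   Formalization: In (iii) the formula for the constrained optimum is proved for all multipliers, D and L satisfying the conditions; existence of such multipliers, false in general, is proved when some admissible D_i satisfy Tr(C_i D_i) > ε_i for all i. *)

(* Defs.v *)
From HB Require Import structures.
From mathcomp Require Import all_boot all_order all_algebra.
From mathcomp Require Import complex finmap.
From mathcomp Require Import all_classical all_reals all_analysis.
From mathcomp Require Import summability.

Set Implicit Arguments.
Unset Strict Implicit.
Unset Printing Implicit Defensive.
Import Order.TTheory GRing.Theory Num.Theory.
Import numFieldNormedType.Exports.

Local Open Scope classical_set_scope.
Local Open Scope ring_scope.
Local Open Scope complex_scope.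

(* A complex Hilbert space: a complete normed space over R[i] whose norm comes
   from a positive definite Hermitian form, linear in its first argument. *)
HB.mixin Record hasInner (R : realType) H of CompleteNormedModule R[i] H := {
  inner : {dot H for (@Num.conj R[i])} ;
  innerE : forall x : H, inner x x = `|x| ^+ 2
}.

#[short(type="hilbertType")]
HB.structure Definition Hilbert (R : realType) :=
  {H of hasInner R H & CompleteNormedModule R[i] H}.

Section operators.
Context {R : realType} {H : hilbertType R}.
Implicit Types A B D E L P : H -> H.

(* Operators are plain functions, so that sums, differences and scalings are
   those of the function space H -> H and products are compositions. *)
Definition bounded_op A : Prop :=
  linear A /\ exists M : R[i], forall x, `|A x| <= M * `|x|.

Definition hermitian_op A : Prop :=
  bounded_op A /\ forall x y, inner (A x) y = inner x (A y).

(* In R[i], 0 <= z means that z is real and nonnegative. *)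
Definition psd_op A : Prop :=
  hermitian_op A /\ forall x, 0 <= inner (A x) x.

Definition ge_op A B : Prop := psd_op (A - B).

Definition orth_projection E : Prop := hermitian_op E /\ E \o E = E.

(* Complete orthonormal sets, of arbitrary cardinality: H need not be
   separable. *)
Definition orthonormal_basis (b : set H) : Prop :=
  (forall e f, b e -> b f -> inner e f = (e == f)%:R) /\
  (forall x, (forall e, b e -> inner x e = 0) -> x = 0).

(* P = |A|, i.e. P is the positive square root of A^* A; the adjoint is
   eliminated through <A^* A x, y> = <A x, A y>. *)
Definition is_abs_op A P : Prop :=
  psd_op P /\ forall x y, inner (P (P x)) y = inner (A x) (A y).

(* Tr |A| < +oo. The sum has nonnegative terms and does not depend on the
   orthonormal basis. *)
Definition trace_class A : Prop :=
  bounded_op A /\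
  exists P b, [/\ is_abs_op A P, orthonormal_basis b &
    (\esum_(e in b) (complex.Re (inner (P e) e))%:E < +oo)%E].

(* The common value, over all orthonormal bases b, of the unconditional sums
   of <A e, e> over e in b; it exists and is unique for A of trace class, and
   0 is a dummy value if there is no such common value. *)
Definition trace A : R[i] :=
  xget 0 [set t : R[i] | forall b, orthonormal_basis b ->
    (partial_sum (fun e : H => if e \in b then inner (A e) e else 0)
       @ totally --> (t : R[i]^o))].

(* All traces below are of products of two Hermitian operators, one of which
   is of trace class; these are real numbers. *)
Definition Tr A : R := complex.Re (trace A).

Section problems.
Context {m : nat}.

(* {D_i} with D_i >= 0 and sum_i D_i = E, for i = 0, ..., m *)
Definition decomposition E (D : 'I_m.+1 -> H -> H) : Prop :=
  (forall i, psd_op (D i)) /\ \sum_i D i = E.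

Definition primal_value (Rs D : 'I_m.+1 -> H -> H) : R :=
  \sum_i Tr (Rs i \o D i).

Definition primal_sup E (Rs : 'I_m.+1 -> H -> H) : \bar R :=
  ereal_sup [set (primal_value Rs D)%:E | D in decomposition E].

Definition dual_inf E (Rs : 'I_m.+1 -> H -> H) : \bar R :=
  ereal_inf [set (Tr (L \o E))%:E | L in
    [set L | [/\ hermitian_op L, trace_class L & forall i, ge_op L (Rs i)]]].

(* For the constrained problem the indices 1, ..., m are the elements of 'I_m;
   j : 'I_m corresponds to lift ord0 j in 'I_m.+1. *)

Definition constrained_value (C D : 'I_m -> H -> H) : R :=
  \sum_i Tr (C i \o \sum_(k | k != i) D k).

Definition constrained_inf E (C : 'I_m -> H -> H) (eps : 'I_m -> R) : \bar R :=
  ereal_inf [set (constrained_value C D)%:E | D in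
    [set D | [/\ forall i, psd_op (D i), ge_op E (\sum_i D i) &
                 forall i, eps i <= Tr (C i \o D i)]]].

Definition strictly_feasible E (C : 'I_m -> H -> H) (eps : 'I_m -> R) : Prop :=
  exists D : 'I_m -> H -> H,
    [/\ forall i, psd_op (D i), ge_op E (\sum_i D i) &
        forall i, eps i < Tr (C i \o D i)].

(* R_0 = sum_j C_j and R_j = (1 + lambda_j) C_j *)
Definition R_lambda (C : 'I_m -> H -> H) (lambda : 'I_m -> R)
    (i : 'I_m.+1) : H -> H :=
  if unlift ord0 i is Some j then (1 + lambda j)%:C *: C j else \sum_j C j.

(* D solves the primal and L the dual problem for R_lambda, and lambda
   satisfies the conditions that determine the multipliers. *)
Definition lagrange_solution E (C : 'I_m -> H -> H) (eps lambda : 'I_m -> R)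
    (D : 'I_m.+1 -> H -> H) (L : H -> H) : Prop :=
  [/\ forall j, 0 <= lambda j,
      decomposition E D /\
      (primal_value (R_lambda C lambda) D)%:E
        = primal_sup E (R_lambda C lambda),
      [/\ hermitian_op L, trace_class L,
          forall i, ge_op L (R_lambda C lambda i) &
          (Tr (L \o E))%:E = dual_inf E (R_lambda C lambda)],
      forall j, lambda j * (eps j - Tr (C j \o D (lift ord0 j))) = 0 &
      forall j, eps j <= Tr (C j \o D (lift ord0 j))].

End problems.
End operators.

(* Main.v *)
(* The key step is a variation of the primal problem (Barnett and Croke).  The
   decompositions of E form a weakly compact set, so an optimal D exists (limit
   of a maximizing sequence along an ultrafilter).  For v in the range of E and
   P = |v><v|, replacing every D_i by (1 - t P) D_i (1 - t P) and giving the
   missing part of E to a single index j is again a decomposition; to first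
   order in t, optimality of D says <R_j v, v> <= sum_i Re <R_i v, D_i v>.
   Hence L = (1/2) sum_i (R_i D_i + D_i R_i) satisfies L >= R_j for all j, and
   Tr(L E) = sum_i Tr(R_i D_i).  Together with weak duality, and since
   Tr(A B) = 0 forces A B = 0 for psd A and B, this gives (i) and (ii).
   The multipliers in (iii) come from a quadratic penalty whose coefficients
   stay bounded by Slater's condition.

   Traces are handled through square roots: for A = S^2 psd of finite trace,
   Tr(A D) = sum_e <D S e, S e> over any orthonormal basis, by polarization from
   the basis independence of sum_e |T e|^2. *)
Require Import Defs.
From HB Require Import structures.
From mathcomp Require Import all_boot all_order all_algebra.
From mathcomp Require Import complex finmap.
From mathcomp Require Import all_classical all_reals all_analysis.
From mathcomp Require Import summability.
From mathcomp Require Import ring lra.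

Set Implicit Arguments.
Unset Strict Implicit.
Unset Printing Implicit Defensive.
Import Order.TTheory GRing.Theory Num.Theory.
Import numFieldNormedType.Exports.
Local Open Scope classical_set_scope.
Local Open Scope ring_scope.
Local Open Scope complex_scope.

(** * Real part of the inner product *)

(** Compactness yields an optimal D but no dual optimum: a minimising sequence of operators L has no
    evident limit with the right trace. L is therefore computed from an optimal D, and its
    symmetrised form makes it Hermitian before any optimality condition is known. Trace class is
    defined through |A|, where closure under sums is not visible. Hermitian trace class operators
    are handled as differences of psd operators of finite trace, for which closure is easy, and the
    definition is met only when entering and leaving this description. Absolute values and positive
    parts come from an iterated square root and kernel projections instead of spectral theory. H may
    be nonseparable, so limits are taken along an ultrafilter, which makes all matrix entries
    converge at once without extracting subsequences. *)

Section RealInner.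
Context {R : realType} {H : hilbertType R}.
Implicit Types (x y z : H) (a : R) (c : R[i]).

(** The real form determines the complex one, [ri x ('i *: y)] being the imaginary part of
    [inner x y], so real estimates suffice throughout. *)
Definition ri x y : R := complex.Re (inner x y).
Definition nm x : R := complex.Re `|x|.

Lemma ReM c (d : R[i]) :
  complex.Re (c * d) =
  complex.Re c * complex.Re d - complex.Im c * complex.Im d.
Proof. by case: c; case: d. Qed.

Lemma normE x : `|x| = (nm x)%:C.
Proof. by rewrite /nm RRe_real // ger0_real. Qed.

Lemma nm_ge0 x : 0 <= nm x.
Proof. by rewrite -ler0c -normE. Qed.

Lemma inner_conj x y : inner y x = (inner x y)^*.
Proof.
have /= := @hermitian_subproof _ _ _ _ (@inner R H) y x.
by rewrite expr0 mul1r.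
Qed.

Lemma riDl x y z : ri (x + y) z = ri x z + ri y z.
Proof. by rewrite /ri linearDl raddfD. Qed.

Lemma riZl a x y : ri (a%:C *: x) y = a * ri x y.
Proof. by rewrite /ri linearZl_LR ReM /=; ring. Qed.

Lemma riC x y : ri x y = ri y x.
Proof. by rewrite /ri inner_conj; case: (inner y x). Qed.

Lemma riNl x z : ri (- x) z = - ri x z.
Proof. by rewrite /ri linearNl raddfN. Qed.

Lemma riDr x y z : ri x (y + z) = ri x y + ri x z.
Proof. by rewrite riC riDl !(riC x). Qed.

Lemma riZr a x y : ri x (a%:C *: y) = a * ri x y.
Proof. by rewrite riC riZl riC. Qed.

Lemma riNr x z : ri x (- z) = - ri x z.
Proof. by rewrite riC riNl riC. Qed.

Lemma ri0l x : ri 0 x = 0.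
Proof. by rewrite /ri linear0l. Qed.

Lemma ri0r x : ri x 0 = 0.
Proof. by rewrite riC ri0l. Qed.

Definition riE := (riDl, riDr, riNl, riNr, riZl, riZr, ri0l, ri0r).

Lemma ri_suml (I : Type) (r : seq I) (P : pred I) (F : I -> H) y :
  ri (\sum_(i <- r | P i) F i) y = \sum_(i <- r | P i) ri (F i) y.
Proof. by apply: (big_morph (ri^~ y)) => [u v|]; rewrite ?riE. Qed.

Lemma ri_sumr (I : Type) (r : seq I) (P : pred I) (F : I -> H) y :
  ri y (\sum_(i <- r | P i) F i) = \sum_(i <- r | P i) ri y (F i).
Proof. by rewrite riC ri_suml; apply: eq_bigr => i _; rewrite riC. Qed.

Lemma ri_il x y : ri ('i *: x) y = - ri x ('i *: y).
Proof.
by rewrite /ri linearZl_LR linearZr_LR /= !ReM /=; ring.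
Qed.

Lemma ri_ii x y : ri ('i *: x) ('i *: y) = ri x y.
Proof. by rewrite ri_il scalerA -expr2 sqr_i scaleN1r riE opprK. Qed.

Lemma innerRI x y : inner x y = (ri x y) +i* (ri x ('i *: y)).
Proof.
rewrite /ri linearZr_LR /= ReM /=.
by case: (inner x y) => u v /=; congr (_ +i* _); ring.
Qed.

Lemma riZlE c x y : ri (c *: x) y = complex.Re c * ri x y - complex.Im c * ri x
  ('i *: y).
Proof.
by rewrite /ri linearZl_LR linearZr_LR /= !ReM /=; ring.
Qed.

Lemma ri_conjZ c x y : ri (c *: x) y = ri x (c^* *: y).
Proof. by rewrite /ri linearZl_LR linearZr_LR !ReM; case: c => a b /=;
  ring. Qed.

Lemma ri_nm x : ri x x = nm x ^+ 2.
Proof.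
rewrite /ri innerE normE -rmorphXn /=.
by [].
Qed.

Lemma ri_ge0 x : 0 <= ri x x.
Proof. by rewrite ri_nm sqr_ge0. Qed.

Lemma nm_eq0 x : (nm x == 0) = (x == 0).
Proof. by rewrite -(normr_eq0 x) normE eq_complex /= eqxx andbT. Qed.

Lemma ri_eq0 x : (ri x x == 0) = (x == 0).
Proof. by rewrite ri_nm sqrf_eq0 nm_eq0. Qed.

Lemma nm0 : nm 0 = 0.
Proof. by apply/eqP; rewrite nm_eq0. Qed.

Lemma nmN x : nm (- x) = nm x.
Proof. by rewrite /nm normrN. Qed.

Lemma nmB x y : nm (x - y) = nm (y - x).
Proof. by rewrite -nmN opprB. Qed.

Lemma nmD x y : nm (x + y) <= nm x + nm y.
Proof. by have := ler_normD x y; rewrite !normE -rmorphD /= lecR. Qed.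

Lemma nm_tri y x z : nm (x - z) <= nm (x - y) + nm (y - z).
Proof. by have := nmD (x - y) (y - z); rewrite addrA subrK. Qed.

Lemma nmZ c x : nm (c *: x) = complex.Re `|c| * nm x.
Proof. by rewrite /nm normrZ normE normc_def /=; ring. Qed.

Lemma nmZr a x : nm (a%:C *: x) = `|a| * nm x.
Proof. by rewrite nmZ normc_def /= expr0n addr0 sqrtr_sqr. Qed.

Lemma nmZi x : nm ('i *: x) = nm x.
Proof. by rewrite nmZ normc_def /= expr0n add0r expr1n sqrtr1 mul1r. Qed.

Lemma ri_le x y : ri x y <= nm x * nm y.
Proof.
have [/eqP|y0] := eqVneq (nm y) 0.
  by rewrite nm_eq0 => /eqP ->; rewrite nm0 mulr0 ri0r.
have py : 0 < nm y by rewrite lt_neqAle eq_sym y0 nm_ge0.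
have [/eqP|x0] := eqVneq (nm x) 0.
  by rewrite nm_eq0 => /eqP ->; rewrite nm0 mul0r ri0l.
have px : 0 < nm x by rewrite lt_neqAle eq_sym x0 nm_ge0.
have := ri_ge0 ((nm y)%:C *: x - (nm x)%:C *: y).
rewrite !riE (riC y x) !ri_nm.
move=> h; have h2 : 0 <= (nm x * nm y) * (nm x * nm y - ri x y) by nra.
by move: h2; rewrite pmulr_rge0 ?mulr_gt0 // subr_ge0.
Qed.

Lemma ri_abs_le x y : `|ri x y| <= nm x * nm y.
Proof.
by rewrite ler_norml ri_le andbT lerNl -riNl (le_trans (ri_le _ _)) ?nmN.
Qed.

Lemma ri_inj x : (forall y, ri x y = 0) -> x = 0.
Proof. by move=> /(_ x)/eqP; rewrite ri_eq0 => /eqP. Qed.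

Lemma ri_ext x x' : (forall y, ri x y = ri x' y) -> x = x'.
Proof.
move=> h; apply/eqP; rewrite -subr_eq0; apply/eqP/ri_inj => y.
by rewrite !riE h subrr.
Qed.

Lemma nm_le_ri x a : 0 <= a -> ri x x <= a ^+ 2 -> nm x <= a.
Proof. by move=> a0; rewrite ri_nm ler_sqr ?nnegrE ?nm_ge0. Qed.

(** A rate is kept, not mere convergence: as k grows, the same [d n] bounds the distance to the
    limit, and identities can be transferred up to multiples of [d n]. *)
Lemma complete_rate (u : nat -> H) (d : nat -> R) :
  (forall n k, (n <= k)%N -> nm (u k - u n) <= d n) -> d @ \oo --> (0 : R) ->
  exists l, forall n, nm (u n - l) <= d n.
Proof.
move=> hu hd.
have cu : cvg (u @ \oo).
  apply/cauchy_cvgP/cauchy_exP => e e0.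
  have e0' : 0 < complex.Re e by move: e0; rewrite ltcE => /andP[].
  have eE : e = (complex.Re e)%:C by rewrite RRe_real // gtr0_real.
  move/cvgr0Pnorm_lt : hd => /(_ _ e0')[N _ hN].
  exists (u N); exists N => // k /= Nk.
  rewrite -ball_normE /ball_ /= eE normE ltcR nmB.
  apply: (le_lt_trans (hu _ _ Nk)); apply: le_lt_trans (hN N (leqnn _)).
  exact: ler_norm.
exists (lim (u @ \oo)) => n; apply/ler_addgt0Pr => e e0.
have eC : (0 : R[i]) < e%:C by rewrite ltcR.
move/cvgrPdist_lt : cu => /(_ _ eC)[N _ hN].
have := hN (maxn n N) (leq_maxr _ _); rewrite normE ltcR => h1.
apply: le_trans (nm_tri (u (maxn n N)) _ _) _.
by rewrite lerD // ?(nmB (u n)) ?hu ?leq_maxl // nmB ltW.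
Qed.

End RealInner.

(** * Bounded, Hermitian and positive operators *)

Section Operators.
Context {R : realType} {H : hilbertType R}.
Implicit Types (x y z : H) (a : R) (c : R[i]) (A B D P : H -> H).

Lemma Re_norm_ge0 c : 0 <= complex.Re `|c|.
Proof. by rewrite normc_def sqrtr_ge0. Qed.

Lemma linearD_op A x y : linear A -> A (x + y) = A x + A y.
Proof. by move=> hA; have := hA 1 x y; rewrite !scale1r. Qed.

Lemma linear0_op A : linear A -> A 0 = 0.
Proof.
by move=> hA; have := linearD_op 0 0 hA; rewrite addr0 => /eqP;
  rewrite -subr_eq0 opprD addrA subrr add0r oppr_eq0 => /eqP.
Qed.

Lemma linearZ_op A c x : linear A -> A (c *: x) = c *: A x.
Proof. by move=> hA; have := hA c x 0; rewrite !addr0 linear0_op // addr0. Qed.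

Lemma linearN_op A x : linear A -> A (- x) = - A x.
Proof. by move=> hA; rewrite -scaleN1r linearZ_op // scaleN1r. Qed.

Lemma linearB_op A x y : linear A -> A (x - y) = A x - A y.
Proof. by move=> hA; rewrite linearD_op // linearN_op. Qed.

Lemma bounded_opP A : bounded_op A <->
  linear A /\ exists2 M : R, 0 <= M & forall x, nm (A x) <= M * nm x.
Proof.
split=> [[lA [M hM]]|[lA [M M0 hM]]]; split=> //.
  have [r r0 E] : exists2 r : R, 0 <= r & `|M| = r%:C.
    by exists (complex.Re `|M|); rewrite ?Re_norm_ge0 // RRe_real ?ger0_real.
  exists r => // x.
  have -> : (nm (A x) <= r * nm x) = (`|A x| <= `|M| * `|x|).
    by rewrite !normE E -rmorphM lecR.
  apply: le_trans (hM x) _; have [->|x0] := eqVneq x 0.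
    by rewrite normr0 !mulr0.
  (* The bound in the definition is a complex number; 0 <= |A x| <= M |x| with x nonzero forces it
     to be real. *)
  have Mr : M \is Num.real.
    have := le_trans (normr_ge0 _) (hM x).
    by rewrite pmulr_lge0 ?normr_gt0 // => /ger0_real.
  by rewrite ler_wpM2r // real_ler_norm.
by exists M%:C => x; rewrite !normE -rmorphM lecR.
Qed.

Lemma bounded_op_linear A : bounded_op A -> linear A.
Proof. by case. Qed.
Hint Resolve bounded_op_linear : core.

Lemma bounded_op0 : bounded_op (0 : H -> H).
Proof.
apply/bounded_opP; split; first by move=> c x y; rewrite scaler0 addr0.
by exists 0 => // x; rewrite mul0r nm0.
Qed.

Lemma bounded_op_id : bounded_op (@id H).
Proof.
by apply/bounded_opP; split=> //; exists 1 => // x; rewrite mul1r.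
Qed.

Lemma bounded_opD A B : bounded_op A -> bounded_op B -> bounded_op (A + B).
Proof.
move=> /bounded_opP[lA [M M0 hM]] /bounded_opP[lB [N N0 hN]].
apply/bounded_opP; split.
  by move=> c x y; rewrite /= !fctE lA lB scalerDr addrACA.
exists (M + N); first exact: addr_ge0.
by move=> x; rewrite (le_trans (nmD _ _)) // mulrDl lerD.
Qed.

Lemma bounded_opZ c A : bounded_op A -> bounded_op (c *: A).
Proof.
move=> /bounded_opP[lA [M M0 hM]]; apply/bounded_opP; split.
  by move=> d x y; rewrite /= !fctE lA scalerDr !scalerA mulrC.
have c0 := Re_norm_ge0 c.
exists (complex.Re `|c| * M); first exact: mulr_ge0.
by move=> x; rewrite nmZ -mulrA ler_wpM2l.
Qed.

Lemma bounded_opN A : bounded_op A -> bounded_op (- A).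
Proof. by move=> hA; rewrite -scaleN1r; exact: bounded_opZ. Qed.

Lemma bounded_op_comp A B :
  bounded_op A -> bounded_op B -> bounded_op (A \o B).
Proof.
move=> /bounded_opP[lA [M M0 hM]] /bounded_opP[lB [N N0 hN]].
apply/bounded_opP; split; first by move=> c x y; rewrite /= lB lA.
exists (M * N); first exact: mulr_ge0.
by move=> x; rewrite (le_trans (hM _)) // -mulrA ler_wpM2l.
Qed.

Lemma hermitian_opP A : hermitian_op A <->
  bounded_op A /\ forall x y, ri (A x) y = ri x (A y).
Proof.
split=> -[bA hA]; split=> // x y; first by rewrite /ri hA.
by rewrite !innerRI hA -[in RHS]linearZ_op ?hA //; exact: bounded_op_linear.
Qed.

Lemma hermitian_op_bounded A : hermitian_op A -> bounded_op A.
Proof. by case. Qed.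

Lemma hermitian_op_linear A : hermitian_op A -> linear A.
Proof. by case=> -[]. Qed.

Lemma hermitian_ri A x y : hermitian_op A -> ri (A x) y = ri x (A y).
Proof. by case/hermitian_opP. Qed.

Lemma hermitian_op0 : hermitian_op (0 : H -> H).
Proof.
by apply/hermitian_opP; split=> [|x y]; [exact: bounded_op0|rewrite !riE].
Qed.

Lemma hermitian_op_id : hermitian_op (@id H).
Proof. by apply/hermitian_opP; split; first exact: bounded_op_id. Qed.

Lemma hermitian_opD A B :
  hermitian_op A -> hermitian_op B -> hermitian_op (A + B).
Proof.
move=> /hermitian_opP[bA hA] /hermitian_opP[bB hB]; apply/hermitian_opP.
by split=> [|x y]; [exact: bounded_opD|rewrite !fctE !riE hA hB].
Qed.

Lemma hermitian_opZ a A : hermitian_op A -> hermitian_op (a%:C *: A).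
Proof.
move=> /hermitian_opP[bA hA]; apply/hermitian_opP.
by split=> [|x y]; [exact: bounded_opZ|rewrite !fctE !riE hA].
Qed.

Lemma hermitian_opN A : hermitian_op A -> hermitian_op (- A).
Proof.
move=> /hermitian_opP[bA hA]; apply/hermitian_opP.
by split=> [|x y]; [exact: bounded_opN|rewrite !fctE !riE hA].
Qed.

Lemma hermitian_opB A B :
  hermitian_op A -> hermitian_op B -> hermitian_op (A - B).
Proof. by move=> hA hB; apply/hermitian_opD/hermitian_opN. Qed.

Lemma hermitian_op_sum (I : Type) (r : seq I) (P : pred I) (F : I -> H -> H) :
  (forall i, P i -> hermitian_op (F i)) ->
  hermitian_op (\sum_(i <- r | P i) F i).
Proof.
by move=> h; apply: big_ind => //; [exact: hermitian_op0|exact: hermitian_opD].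
Qed.

Lemma hermitian_op_sandwich A B :
  hermitian_op A -> hermitian_op B -> hermitian_op (B \o A \o B).
Proof.
move=> /hermitian_opP[bA hA] /hermitian_opP[bB hB]; apply/hermitian_opP.
split=> [|x y]; last by rewrite /= hB hA hB.
exact: (bounded_op_comp (bounded_op_comp bB bA) bB).
Qed.

(** The order of [R[i]] also demands a zero imaginary part; for Hermitian A that part equals its own
    negative. *)
Lemma psd_opP A : psd_op A <-> hermitian_op A /\ forall x, 0 <= ri (A x) x.
Proof.
split=> -[hA pA]; split=> // x.
  by have := pA x; rewrite lecE => /andP[_].
rewrite lecE -/(ri _ _) pA andbT innerRI /=.
have [bA sA] := (hermitian_opP A).1 hA.
have h : ri (A x) ('i *: x) = - ri (A x) ('i *: x).
  rewrite {1}sA linearZ_op; last exact: hermitian_op_linear.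
  by rewrite -[LHS]opprK -(ri_il x) riC.
by apply/eqP; move: h; lra.
Qed.
End Operators.

(** * Positive operators and their Cauchy-Schwarz inequality *)

Section Positive.
Context {R : realType} {H : hilbertType R}.
Implicit Types (x y z : H) (a : R) (c : R[i]) (A B D P : H -> H).

Lemma psd_op_hermitian A : psd_op A -> hermitian_op A.
Proof. by case. Qed.

Lemma psd_op_ge0 A x : psd_op A -> 0 <= ri (A x) x.
Proof. by case/psd_opP. Qed.

Lemma psd_op0 : psd_op (0 : H -> H).
Proof.
by apply/psd_opP; split=> [|x]; [exact: hermitian_op0|rewrite riE].
Qed.

Lemma psd_op_id : psd_op (@id H).
Proof.
by apply/psd_opP; split=> [|x]; [exact: hermitian_op_id|exact: ri_ge0].
Qed.

Lemma psd_opD A B : psd_op A -> psd_op B -> psd_op (A + B).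
Proof.
move=> /psd_opP[hA pA] /psd_opP[hB pB]; apply/psd_opP.
by split=> [|x]; [exact: hermitian_opD|rewrite !fctE riE addr_ge0].
Qed.

Lemma psd_opZ a A : 0 <= a -> psd_op A -> psd_op (a%:C *: A).
Proof.
move=> a0 /psd_opP[hA pA]; apply/psd_opP.
by split=> [|x]; [exact: hermitian_opZ|rewrite !fctE riE mulr_ge0].
Qed.

Lemma psd_op_sandwich A B :
  psd_op A -> hermitian_op B -> psd_op (B \o A \o B).
Proof.
move=> /psd_opP[hA pA] hB; apply/psd_opP; split.
  exact: hermitian_op_sandwich.
by move=> x /=; rewrite hermitian_ri.
Qed.

Lemma psd_op_sq A : hermitian_op A -> psd_op (A \o A).
Proof. by move=> hA; apply: (psd_op_sandwich psd_op_id). Qed.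

Lemma ge_opP A B : ge_op A B <->
  hermitian_op (A - B) /\ forall x, ri (B x) x <= ri (A x) x.
Proof.
rewrite /ge_op psd_opP; split=> -[hAB p]; split=> // x; have := p x;
  by rewrite !fctE riDl riNl subr_ge0.
Qed.

Lemma quadratic_discriminant (a b c : R) :
  (forall t, 0 <= a + 2 * b * t + c * t ^+ 2) -> b ^+ 2 <= a * c.
Proof.
move=> h; have [c0|c0] := eqVneq c 0.
  have [->|b0] := eqVneq b 0; first by rewrite c0 mulr0 expr0n.
  have := h (- (a + 1) / (2 * b)); rewrite c0 mul0r addr0.
  have -> : a + 2 * b * (- (a + 1) / (2 * b)) = - 1 by field.
  by rewrite ler0N1.
have cp : 0 < c.
  rewrite lt_neqAle eq_sym c0 /= leNgt; apply/negP => cn.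
  (* A parabola with c < 0 is negative at u - 1, where c u = a + b^2 + 1: here a >= 0, u < 0 and 2 b
     + c u = a + (b + 1)^2 >= 0. *)
  have := h ((a + b ^+ 2 + 1) / c - 1); rewrite leNgt => /negP; apply.
  set u := (_ + 1) / c.
  have cu : c * u = a + b ^+ 2 + 1 by rewrite /u; field.
  have -> : a + 2 * b * (u - 1) + c * (u - 1) ^+ 2 =
    a + 2 * b * (u - 1) + (c * u) * u - 2 * (c * u) + c by ring.
  have := h 1; have := h (-1); have := h 0; have := h u.
  rewrite (_ : c * u ^+ 2 = (c * u) * u); last by ring.
  rewrite cu; nra.
have := h (- b / c).
have -> : a + 2 * b * (- b / c) + c * (- b / c) ^+ 2 = (a * c - b ^+ 2) / c.
  by field.
by rewrite pmulr_lge0 ?invr_gt0 // subr_ge0.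
Qed.

Lemma psd_op_CS A x y : psd_op A ->
  ri (A x) y ^+ 2 <= ri (A x) x * ri (A y) y.
Proof.
move=> pA; have hA := psd_op_hermitian pA.
apply: quadratic_discriminant => t.
have := psd_op_ge0 (x + t%:C *: y) pA.
have lA := hermitian_op_linear hA.
rewrite (linearD_op _ _ lA) (linearZ_op _ _ lA).
rewrite !riE (hermitian_ri y x hA) (riC y (A x)) => h.
by apply: le_trans h _; rewrite le_eqVlt; apply/orP; left; apply/eqP; ring.
Qed.

Lemma psd_op_ker A x : psd_op A -> ri (A x) x = 0 -> A x = 0.
Proof.
move=> pA h; apply: ri_inj => y; have := psd_op_CS x y pA.
by rewrite h mul0r => h2; apply/eqP; rewrite -sqrf_eq0 eq_le h2 sqr_ge0.
Qed.

(** Cauchy-Schwarz for the form of A at x and A x gives |A x|^4 <= <A x, x> <A A x, A x>, and the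
    last factor is at most a |A x|^2. *)
Lemma psd_op_norm_sq A a x : psd_op A -> 
  (forall y, ri (A y) y <= a * ri y y) -> ri (A x) (A x) <= a * ri (A x) x.
Proof.
move=> pA hM; have := psd_op_CS x (A x) pA.
have [->|n0] := eqVneq (ri (A x) (A x)) 0.
  move=> _; have [->|xz] := eqVneq x 0; first by rewrite ri0r mulr0.
  have xp : 0 < ri x x by rewrite lt_neqAle eq_sym ri_eq0 xz ri_ge0.
  have := le_trans (psd_op_ge0 x pA) (hM x).
  by rewrite pmulr_lge0 // => a0; rewrite mulr_ge0 // psd_op_ge0.
have p : 0 < ri (A x) (A x) by rewrite lt_neqAle eq_sym n0 ri_ge0.
move=> h; rewrite -(ler_pM2r p) -expr2; apply: le_trans h _.
by rewrite mulrAC mulrC ler_wpM2r ?psd_op_ge0.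
Qed.
End Positive.

(** * Square roots *)

Section SquareRoot.
Context {R : realType} {H : hilbertType R}.
Implicit Types (x y z : H) (a : R) (c : R[i]) (A B D P : H -> H).

Lemma le0_vanishing (a b : R) (d : nat -> R) :
  d @ \oo --> (0 : R) -> (forall n, a <= d n * b) -> a <= 0.
Proof.
move=> hd h.
have hdb : (fun n => d n * b) @ \oo --> (0 : R).
  by rewrite -(mul0r b); apply: cvgM hd (cvg_cst _).
rewrite -(cvg_lim _ hdb) //; apply: limr_ge; first by apply/cvg_ex; exists 0.
exact: nearW.
Qed.

Lemma eq_vanishing x y (b : R) (d : nat -> R) :
  d @ \oo --> (0 : R) -> (forall n, nm (x - y) <= d n * b) -> x = y.
Proof.
move=> hd /(le0_vanishing hd) h; apply/eqP; rewrite -subr_eq0 -nm_eq0.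
by rewrite eq_le h nm_ge0.
Qed.

Lemma op_limit (T : nat -> H -> H) (d : nat -> R) :
    (forall n, linear (T n)) ->
    (forall n k, (n <= k)%N -> forall x, nm (T k x - T n x) <= d n * nm x) ->
    d @ \oo --> (0 : R) ->
  exists S, linear S /\ forall n x, nm (T n x - S x) <= d n * nm x.
Proof.
move=> lT hT hd.
have hS x : exists l, forall n, nm (T n x - l) <= d n * nm x.
  apply: complete_rate => [n k nk|]; first exact: hT.
  by rewrite -(mul0r (nm x)); apply: cvgM hd (cvg_cst _).
exists (fun x => sval (cid (hS x))).
have hSn n x : nm (T n x - sval (cid (hS x))) <= d n * nm x.
  by case: (cid (hS x)).
split=> // c x y; set S := fun x => sval (cid (hS x)).
apply: (@eq_vanishing _ _
  (nm (c *: x + y) + complex.Re `|c| * nm x + nm y) d hd) => n.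
rewrite -/(S _) -/(S x) -/(S y).
apply: le_trans (nm_tri (T n (c *: x + y)) _ _) _.
rewrite nmB !mulrDr -addrA lerD ?hSn // lT.
have -> : c *: T n x + T n y - (c *: S x + S y) =
  c *: (T n x - S x) + (T n y - S y) by rewrite scalerBr opprD addrACA.
apply: le_trans (nmD _ _) _; rewrite lerD ?hSn // nmZ mulrCA.
by rewrite ler_wpM2l ?Re_norm_ge0 ?hSn.
Qed.

(* [npoly X T r]: T is a polynomial in X with nonnegative coefficients, and r
   is the sum of these coefficients. *)
Inductive npoly (X : H -> H) : (H -> H) -> R -> Prop :=
| npoly0 : npoly X 0 0
| npolyX : npoly X X 1
| npolyD T T' r r' : npoly X T r -> npoly X T' r' -> npoly X (T + T') (r + r')
| npolyZ T r a : 0 <= a -> npoly X T r -> npoly X (a%:C *: T) (a * r)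
| npolyM T T' r r' : npoly X T r -> npoly X T' r' ->
    npoly X (T \o T') (r * r').

Lemma npoly_ge0 X T r : npoly X T r -> 0 <= r.
Proof.
by elim=> // *; rewrite ?addr_ge0 ?mulr_ge0.
Qed.

Lemma npoly_comm X B T r : linear B -> (forall x, X (B x) = B (X x)) ->
  npoly X T r -> forall x, T (B x) = B (T x).
Proof.
move=> lB hB; elim=> //.
- by move=> x; rewrite (linear0_op lB).
- by move=> T1 T2 r1 r2 _ h1 _ h2 x; rewrite !fctE h1 h2 (linearD_op _ _ lB).
- by move=> T1 r1 a _ _ h1 x; rewrite !fctE h1 (linearZ_op _ _ lB).
- by move=> T1 T2 r1 r2 _ h1 _ h2 x /=; rewrite h2 h1.
Qed.

Lemma npoly_linear X T r : linear X -> npoly X T r -> linear T.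
Proof.
move=> lX; elim=> //.
- by move=> c x y; rewrite scaler0 addr0.
- by move=> T1 T2 r1 r2 _ h1 _ h2 c x y; rewrite !fctE h1 h2 scalerDr addrACA.
- by move=> T1 r1 a _ _ h1 c x y; rewrite !fctE h1 scalerDr !scalerA mulrC.
- by move=> T1 T2 r1 r2 _ h1 _ h2 c x y /=; rewrite h2 h1.
Qed.

Lemma npoly_comm2 X T r T' r' : linear X -> npoly X T r -> npoly X T' r' ->
  forall x, T (T' x) = T' (T x).
Proof.
move=> lX hT hT'; apply: npoly_comm hT; first exact: npoly_linear hT'.
by move=> x; rewrite -(npoly_comm lX _ hT').
Qed.

Lemma npoly_norm X T r : (forall x, nm (X x) <= nm x) -> npoly X T r ->
  forall x, nm (T x) <= r * nm x.
Proof.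
move=> hX; elim=> //.
- by move=> x; rewrite mul0r nm0.
- by move=> x; rewrite mul1r.
- move=> T1 T2 r1 r2 _ h1 _ h2 x; rewrite (le_trans (nmD _ _)) // mulrDl.
  exact: lerD.
- by move=> T1 r1 a a0 _ h1 x; rewrite nmZr ger0_norm // -mulrA ler_wpM2l.
- move=> T1 T2 r1 r2 p1 h1 _ h2 x /=; rewrite (le_trans (h1 _)) // -mulrA.
  by rewrite ler_wpM2l // (npoly_ge0 p1).
Qed.

Lemma npoly_ri X T r : hermitian_op X -> npoly X T r ->
  forall x y, ri (T x) y = ri x (T y).
Proof.
move=> hX; have lX := hermitian_op_linear hX; elim=> //.
- by move=> x y; rewrite !riE.
- by move=> x y; rewrite hermitian_ri.
- by move=> T1 T2 r1 r2 _ h1 _ h2 x y; rewrite !fctE !riE h1 h2.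
- by move=> T1 r1 a _ _ h1 x y; rewrite !fctE !riE h1.
- move=> T1 T2 r1 r2 n1 h1 n2 h2 x y /=.
  by rewrite (npoly_comm2 lX n1 n2) h2 h1.
Qed.

(* The limit Y of this iteration solves Y = (X + Y^2) / 2,
   so (1 - Y)^2 = 1 - X. *)
Fixpoint sqrt_iter (X : H -> H) n : H -> H :=
  if n is k.+1 then (2^-1)%:C *: (X + (sqrt_iter X k \o sqrt_iter X k)) else 0.

(** The same iteration run on the scalar 1. It increases and stays below 1, and its increments bound
    those of the operator iteration when X is a contraction. *)
Fixpoint sqrt_iter_sum n : R :=
  if n is k.+1 then 2^-1 * (1 + sqrt_iter_sum k * sqrt_iter_sum k) else 0.

Lemma sqrt_iter_npoly X n : npoly X (sqrt_iter X n) (sqrt_iter_sum n).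
Proof.
elim: n => [|n IH] /=; first exact: npoly0.
apply: npolyZ => //. by apply: npolyD; [exact: npolyX|exact: npolyM].
Qed.

(** The iterates commute, so Y_(n+2) - Y_(n+1) = (Y_(n+1) - Y_n) (Y_(n+1) + Y_n) / 2; nonnegativity
    of the coefficients passes from one increment to the next. *)
Lemma sqrt_iter_step X n : linear X ->
  npoly X (sqrt_iter X n.+1 - sqrt_iter X n)
    (sqrt_iter_sum n.+1 - sqrt_iter_sum n).
Proof.
move=> lX; elim: n => [|n IH].
  have -> : sqrt_iter X 1 - sqrt_iter X 0 = (2^-1)%:C *: X.
    by apply/funext => x; rewrite /= !fctE /= subr0 addr0.
  by rewrite /= mul0r addr0 subr0; apply: npolyZ => //; exact: npolyX.
have p1 := sqrt_iter_npoly X n.+1; have p0 := sqrt_iter_npoly X n.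
have -> : sqrt_iter_sum n.+2 - sqrt_iter_sum n.+1 =
    2^-1 * ((sqrt_iter_sum n.+1 - sqrt_iter_sum n) *
            (sqrt_iter_sum n.+1 + sqrt_iter_sum n)).
  by rewrite /=; ring.
have -> : sqrt_iter X n.+2 - sqrt_iter X n.+1 =
    (2^-1)%:C *: ((sqrt_iter X n.+1 - sqrt_iter X n) \o
                  (sqrt_iter X n.+1 + sqrt_iter X n)).
  apply/funext => x.
  have l1 := npoly_linear lX p1; have l0 := npoly_linear lX p0.
  have cm := npoly_comm2 lX p1 p0 x.
  transitivity ((2^-1)%:C *: (X x + sqrt_iter X n.+1 (sqrt_iter X n.+1 x)) -
     (2^-1)%:C *: (X x + sqrt_iter X n (sqrt_iter X n x))); first by [].
  rewrite -scalerBr !fctE (linearD_op _ _ l1) (linearD_op _ _ l0) -cm.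
  congr (_ *: _); rewrite opprD addrACA subrr add0r.
  by rewrite opprD addrA addrK.
by apply: npolyZ => //; apply: npolyM => //; exact: npolyD.
Qed.

Lemma sqrt_iter_diff X n k : linear X -> (n <= k)%N ->
  npoly X (sqrt_iter X k - sqrt_iter X n)
    (sqrt_iter_sum k - sqrt_iter_sum n).
Proof.
move=> lX /subnK <-; elim: (k - n)%N => [|j IH].
  by rewrite add0n !subrr; exact: npoly0.
rewrite addSn -(subrKA (sqrt_iter X (j + n))).
rewrite -(subrKA (sqrt_iter_sum (j + n))).
by apply: npolyD IH; exact: sqrt_iter_step.
Qed.

Lemma sqrt_iter_sum_le1 n : sqrt_iter_sum n <= 1.
Proof.
elim: n => [|n IH] //=.
have := npoly_ge0 (sqrt_iter_npoly id n); nra.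
Qed.

(** The root is a limit of polynomials in A, hence the commutation clause; it is what makes |A|
    commute with A in [htc_trace_class]. *)
Lemma psd_sqrt_contraction A :
    psd_op A -> (forall x, ri (A x) x <= ri x x) ->
  exists S, [/\ psd_op S, forall x, S (S x) = A x &
    forall B, bounded_op B -> (forall x, A (B x) = B (A x)) ->
      forall x, S (B x) = B (S x)].
Proof.
move=> pA hA1; have hA := psd_op_hermitian pA.
pose X : H -> H := id - A.
have XE x : X x = x - A x by [].
have hX : hermitian_op X by apply: hermitian_opB => //; exact: hermitian_op_id.
have lX := hermitian_op_linear hX.
have pX : psd_op X.
  apply/psd_opP; split=> // x.
  by rewrite XE riDl riNl subr_ge0.
have X1 x : nm (X x) <= nm x.
  apply: nm_le_ri; first exact: nm_ge0.
  have X1' y : ri (X y) y <= 1 * ri y y.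
    by rewrite XE riDl riNl mul1r gerBl psd_op_ge0.
  rewrite -ri_nm; apply: le_trans (psd_op_norm_sq x pX X1') _.
  by rewrite mul1r; apply: le_trans (X1' x) _; rewrite mul1r.
pose r := sqrt_iter_sum : nat -> R.
pose T := sqrt_iter X.
have pT n : npoly X (T n) (r n) := sqrt_iter_npoly X n.
have pD n k : (n <= k)%N -> npoly X (T k - T n) (r k - r n).
  exact: sqrt_iter_diff.
have rmono : nondecreasing_seq r.
  by move=> n k /pD /npoly_ge0; rewrite subr_ge0.
have cr : cvg (r @ \oo).
  apply: nondecreasing_is_cvgn => //; exists 1 => _ [n _ <-].
  exact: sqrt_iter_sum_le1.
pose l := lim (r @ \oo).
have rl n : r n <= l by exact: nondecreasing_cvgn_le.
have l1 : l <= 1.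
  by apply: limr_le => //; apply: nearW => n; exact: sqrt_iter_sum_le1.
pose d n := l - r n.
have d0 : d @ \oo --> (0 : R).
  by rewrite -(subrr l); apply: cvgB; [exact: cvg_cst|exact: cr].
have hT n k : (n <= k)%N -> forall x, nm (T k x - T n x) <= d n * nm x.
  move=> nk x; apply: le_trans (npoly_norm X1 (pD _ _ nk) x) _.
  by rewrite ler_wpM2r ?nm_ge0 // lerB.
have lT n : linear (T n) := npoly_linear lX (pT n).
have [Y [lY hY]] := op_limit lT hT d0.
have Y1 x : nm (Y x) <= nm x.
  have h : nm (Y x) <= r 0%N * nm x + d 0%N * nm x.
    rewrite -[Y x](subrK (T 0%N x)) addrC (le_trans (nmD _ _)) //.
    by rewrite lerD ?(npoly_norm X1 (pT _)) // nmB hY.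
  by apply: le_trans h _; rewrite -mulrDl /d addrC subrK ler_piMl ?nm_ge0.
have bY : bounded_op Y.
  by apply/bounded_opP; split=> //; exists 1 => // x; rewrite mul1r.
have cY B : bounded_op B -> (forall x, X (B x) = B (X x)) ->
    forall x, Y (B x) = B (Y x).
  move=> /bounded_opP[lB [M M0 hM]] cB x.
  apply: (@eq_vanishing _ _ (nm (B x) + M * nm x) d d0) => n.
  apply: le_trans (nm_tri (T n (B x)) _ _) _.
  rewrite mulrDr lerD ?(nmB (Y _)) ?hY // (npoly_comm lB cB (pT n)).
  rewrite -(linearB_op _ _ lB) (le_trans (hM _)) // mulrCA ler_wpM2l //.
(* The recursion passes to the limit. Three errors of size [d n * nm x] occur: one on the left, two
   in replacing T n (T n x) by Y (Y x). *)
have YE x : Y x = (2^-1)%:C *: (X x + Y (Y x)).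
  apply: (@eq_vanishing _ _ (nm x + (nm x + nm x)) d d0) => n.
  apply: le_trans (nm_tri (T n.+1 x) _ _) _.
  have dn : d n.+1 <= d n by rewrite lerB // rmono.
  have dn0 : 0 <= d n by rewrite subr_ge0.
  rewrite mulrDr lerD //.
    by rewrite nmB (le_trans (hY _ _)) // ler_wpM2r ?nm_ge0.
  have -> : T n.+1 x = (2^-1)%:C *: (X x + T n (T n x)) by [].
  rewrite -scalerBr opprD addrACA subrr add0r nmZr ger0_norm // mulrDr.
  apply: (@le_trans _ _ (nm (T n (T n x) - Y (Y x)))).
    by rewrite ler_piMl ?nm_ge0 //; lra.
  apply: le_trans (nm_tri (T n (Y x)) _ _) _; rewrite lerD //.
    rewrite -(linearB_op _ _ (lT n)) (le_trans (npoly_norm X1 (pT n) _)) //.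
    apply: le_trans (hY n x); rewrite ler_piMl ?nm_ge0 //.
    exact: sqrt_iter_sum_le1.
  by apply: le_trans (hY _ _) _; rewrite ler_wpM2l.
have hYh : hermitian_op Y.
  apply/hermitian_opP; split=> // x y; apply/eqP; rewrite -subr_eq0.
  rewrite -normr_eq0 eq_le normr_ge0 andbT.
  apply: (@le0_vanishing _ (nm x * nm y + nm x * nm y) d d0) => n.
  have -> : ri (Y x) y - ri x (Y y) = ri (Y x - T n x) y + ri x (T n y - Y y).
    by rewrite !riE (npoly_ri hX (pT n) x y) addrA subrK.
  apply: le_trans (ler_normD _ _) _; rewrite mulrDr lerD //.
    apply: le_trans (ri_abs_le _ _) _; rewrite mulrA ler_wpM2r ?nm_ge0 //.
    by rewrite nmB.
  apply: le_trans (ri_abs_le _ _) _; rewrite mulrCA ler_wpM2l ?nm_ge0 //.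
exists (id - Y); split.
- apply/psd_opP; split=> [|x].
    by apply: hermitian_opB => //; exact: hermitian_op_id.
  rewrite !fctE riDl riNl subr_ge0 (le_trans (ri_le _ _)) // ri_nm expr2.
  by rewrite ler_wpM2r ?nm_ge0.
- move=> x; rewrite !fctE (linearB_op _ _ lY).
  have -> : x - Y x - (Y x - Y (Y x)) = x - (Y x + Y x) + Y (Y x).
    by rewrite opprB addrA [LHS]addrAC opprD addrA.
  have -> : Y x + Y x = X x + Y (Y x).
    by rewrite {1 2}YE -scalerDl -rmorphD /= (_ :
      2^-1 + 2^-1 = 1 :> R) ?scale1r //; lra.
  by rewrite opprD addrA subrK XE opprB addrC subrK.
- move=> B bB cB x; rewrite !fctE (linearB_op _ _ (bounded_op_linear bB)) cY //.
  by move=> y; rewrite !XE (linearB_op _ _ (bounded_op_linear bB)) cB.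
Qed.

Lemma psd_op_bound A : psd_op A ->
  exists2 M : R, 0 < M & forall x, ri (A x) x <= M * ri x x.
Proof.
move=> pA; have /bounded_opP[lA [M M0 hM]] :=
  hermitian_op_bounded (psd_op_hermitian pA).
(* The added 1 makes the bound positive, so that [psd_sqrt] can divide by it. *)
exists (M + 1); first by rewrite ltr_wpDl.
move=> x; apply: le_trans (ri_le _ _) _.
rewrite ri_nm expr2 mulrA ler_wpM2r ?nm_ge0 //.
by rewrite (le_trans (hM x)) // ler_wpM2r ?nm_ge0 // lerDl.
Qed.

Lemma psd_sqrt A : psd_op A ->
  exists S, [/\ psd_op S, forall x, S (S x) = A x &
    forall B, bounded_op B -> (forall x, A (B x) = B (A x)) ->
      forall x, S (B x) = B (S x)].
Proof.
move=> pA; have [M M0 hM] := psd_op_bound pA.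
have lA := hermitian_op_linear (psd_op_hermitian pA).
have Mi : 0 <= M^-1 by rewrite invr_ge0 ltW.
have [|x|S [pS SS cS]] := @psd_sqrt_contraction (M^-1%:C *: A).
- exact: psd_opZ.
- by rewrite !fctE riE -(ler_pM2l M0) mulVKf ?gt_eqF.
have lS := hermitian_op_linear (psd_op_hermitian pS).
exists ((Num.sqrt M)%:C *: S); split.
- by apply: psd_opZ => //; exact: sqrtr_ge0.
- move=> x; rewrite !fctE (linearZ_op _ _ lS) SS !fctE !scalerA -!rmorphM /=.
  by rewrite -expr2 sqr_sqrtr ?ltW // mulfV ?gt_eqF // scale1r.
- move=> B bB cB x; have lB := bounded_op_linear bB.
  rewrite !fctE (linearZ_op _ _ lB) cS // => y.
  by rewrite !fctE cB (linearZ_op _ _ lB).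
Qed.
End SquareRoot.

(** * Riesz representation *)

Section EsumReal.
Context {R : realType} {T : choiceType}.
Implicit Types (D : set T) (a : T -> R) (r : seq T).

Lemma esum_le_seq D a (s : R) :
  (forall r, uniq r -> (forall i, i \in r -> D i) -> \sum_(i <- r) a i <= s) ->
  (\esum_(i in D) (a i)%:E <= s%:E)%E.
Proof.
move=> h; apply: ge_ereal_sup => _ [X [fX XD] <-].
rewrite fsbig_finite // sumEFin lee_fin h // => i.
by rewrite in_fset_set // inE => /XD.
Qed.

Lemma esum_ge_seq D a r : uniq r -> (forall i, i \in r -> D i) ->
  ((\sum_(i <- r) a i)%:E <= \esum_(i in D) (a i)%:E)%E.
Proof.
move=> ur rD; apply: esum_ge; exists [set` r].
  by split; [exact: finite_seq|move=> i /= /rD].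
by rewrite -fsbig_seq // sumEFin.
Qed.

Lemma exchange_esum (T' : choiceType) D (D' : set T') (a : T -> T' -> \bar R) :
  (forall i j, 0 <= a i j)%E ->
  (\esum_(i in D) \esum_(j in D') a i j = \esum_(j in D') \esum_(i in D) a i
    j)%E.
Proof.
move=> a0; rewrite !esum_esum //.
rewrite (reindex_esum (D' `*` D) _ (fun x => (x.2, x.1))) //; split=> //=.
- by move=> [i j] [].
- by move=> [i j] [i' j'] _ _ [-> ->].
- by move=> [i j] [Di Dj]; exists (j, i).
Qed.
End EsumReal.

Section Riesz.
Context {R : realType} {H : hilbertType R}.
Implicit Types (x y z e : H) (a : R) (c : R[i]) (A B D P : H -> H).

(* V is not assumed closed: the representing vector z is only in its closure. *)
Lemma riesz_real (V : H -> Prop) (f : H -> R) (M : R) :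
    V 0 -> (forall x y, V x -> V y -> V (x + y)) ->
    (forall a x, V x -> V (a%:C *: x)) ->
    (forall x y, f (x + y) = f x + f y) ->
      (forall a x, f (a%:C *: x) = a * f x) ->
    (forall x, f x <= M * nm x) ->
  exists z, (forall eps, 0 < eps -> exists2 y, V y & nm (z - y) <= eps) /\
    forall v, V v -> ri v z = f v.
Proof.
move=> V0 VD VZ fD fZ fM.
(* If z represents f, then J y = |y - z|^2 - |z|^2; so z is sought as the limit of a minimising
   sequence of J. *)
pose J y := ri y y - 2 * f y.
have J_lb y : - M ^+ 2 <= J y.
  by rewrite /J ri_nm; have := fM y; have := sqr_ge0 (nm y - M); nra.
pose S := [set J y | y in V].
have hS : has_inf S.
  split; first by exists (J 0), 0.
  by exists (- M ^+ 2) => _ [y _ <-].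
pose I := inf S.
have J_I y : V y -> I <= J y.
  by move=> Vy; apply: ge_inf; [case: hS|exists y].
pose h : nat -> R := harmonic.
have h0 n : 0 < h n by rewrite /h /= invr_gt0.
have hmono n k : (n <= k)%N -> h k <= h n.
  by move=> nk; rewrite /h /= lef_pV2 ?posrE ?ltr0n // ler_nat ltnS.
have hexists n : exists y, V y /\ J y <= I + h n ^+ 2.
  have h2 : 0 < h n ^+ 2 by rewrite exprn_gt0.
  have [_ [y Vy <-] hy] := inf_adherent h2 hS.
  by exists y; split => //; apply: ltW.
have [u hu] := choice hexists.
have hd : (fun n => 2 * h n) @ \oo --> (0 : R).
  by rewrite -(mulr0 2); apply: cvgM; [exact: cvg_cst|exact: cvg_harmonic].
have hcau n k : (n <= k)%N -> nm (u k - u n) <= 2 * h n.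
  move=> nk; apply: nm_le_ri; first by rewrite mulr_ge0 // ltW.
  have [Vn Jn] := hu n; have [Vk Jk] := hu k.
  (* Parallelogram law: |u_k - u_n|^2 = 2 J u_k + 2 J u_n - 4 J of the midpoint, at most 4 (h
     n)^2. *)
  have := J_I _ (VZ 2^-1 _ (VD _ _ Vk Vn)).
  rewrite /J fZ fD !riE (riC (u n) (u k)).
  have hkn := hmono _ _ nk; have := h0 k.
  have : h k ^+ 2 <= h n ^+ 2 by rewrite ler_sqr ?nnegrE ?(ltW (h0 _)).
  move: Jn Jk; rewrite /J. nra.
have [z hz] := complete_rate hcau hd.
exists z; split.
  move=> eps e0; move/cvgr0Pnorm_le : hd => /(_ _ e0)[N _ hN].
  exists (u N); first by case: (hu N).
  rewrite nmB (le_trans (hz N)) // (le_trans _ (hN N _)) //=.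
  exact: ler_norm.
move=> v Vv; apply/eqP; rewrite -subr_eq0 -normr_eq0 eq_le normr_ge0 andbT.
apply: (@le0_vanishing _ _ (2^-1 * 3 * nm v) (fun n => 2 * h n) hd) => n.
have -> : ri v z - f v = (ri (u n) v - f v) - ri (u n - z) v.
  by rewrite !riE (riC z); ring.
apply: le_trans (ler_normB _ _) _.
have : `|ri (u n - z) v| <= 2 * h n * nm v.
  by apply: le_trans (ri_abs_le _ _) _; rewrite ler_wpM2r ?nm_ge0.
(* J (u_n + t v) - I is nonnegative for every t, and its constant term is at most (h n)^2; the
   discriminant bounds the linear term. *)
have : `|ri (u n) v - f v| <= h n * nm v.
  have hn := ltW (h0 n).
  rewrite -ler_sqr ?nnegrE ?mulr_ge0 ?nm_ge0 // real_normK ?num_real //.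
  rewrite exprMn -ri_nm; apply: quadratic_discriminant => t.
  have [Vn Jn] := hu n.
  have := J_I _ (VD _ _ Vn (VZ t _ Vv)).
  by move: Jn; rewrite /J fD fZ !riE (riC v (u n)); nra.
lra.
Qed.

Lemma riesz_op (F : H -> H -> R) (M : R) :
    (forall x y y', F x (y + y') = F x y + F x y') ->
    (forall x a y, F x (a%:C *: y) = a * F x y) ->
    (forall x y, F x y <= M * nm x * nm y) ->
  exists B, forall x y, ri (B x) y = F x y.
Proof.
move=> FD FZ FM.
have h x : exists z, forall y, ri z y = F x y.
  have [z [_ hz]] := @riesz_real (fun=> True) (F x) (M * nm x) I
    (fun _ _ _ _ => I) (fun _ _ _ => I) (FD x) (FZ x) (FM x).
  by exists z => y; rewrite riC hz.
by have [B hB] := choice h; exists B.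
Qed.

End Riesz.

(** * Orthonormal bases and Hilbert-Schmidt norms *)

Section Parseval.
Context {R : realType} {H : hilbertType R}.
Implicit Types (x y z e : H) (a : R) (c : R[i]) (A B D P : H -> H) (b : set H).

(** This is |<x, e>|^2, the second square coming from the imaginary part. *)
Definition sqcoef x e : R := ri x e ^+ 2 + ri x ('i *: e) ^+ 2.

Lemma sqcoef_ge0 x e : 0 <= sqcoef x e.
Proof. by rewrite addr_ge0 ?sqr_ge0. Qed.

Lemma inner_eq0 x y : inner x y = 0 -> ri x y = 0 /\ ri x ('i *: y) = 0.
Proof. by rewrite innerRI => -[-> ->]. Qed.

Lemma ri_proj x e : ri x (inner x e *: e) = sqcoef x e.
Proof.
rewrite riC riZlE innerRI /= (riC e x) (riC e ('i *: x)) ri_il /sqcoef.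
by ring.
Qed.

Lemma innerZl c x y : inner (c *: x) y = c * inner x y.
Proof. exact: linearZl_LR. Qed.

Lemma innerZr c x y : inner x (c *: y) = c^* * inner x y.
Proof. exact: linearZr_LR. Qed.

Lemma innerBl x y z : inner (x - y) z = inner x z - inner y z.
Proof. exact: linearBl. Qed.

Lemma innerDr x y z : inner x (y + z) = inner x y + inner x z.
Proof. exact: linearDr. Qed.

Lemma inner_suml (I : Type) (r : seq I) (F : I -> H) y :
  inner (\sum_(i <- r) F i) y = \sum_(i <- r) inner (F i) y.
Proof. exact: linear_sumlz. Qed.

Section FiniteProjection.
Variables (b : set H) (F : seq H).
Hypotheses (bO : orthonormal_basis b) (uF : uniq F).
Hypothesis Fb : forall [e], e \in F -> b e.

Definition fproj x := \sum_(e <- F) inner x e *: e.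

Lemma fproj_ortho x e : e \in F -> inner (x - fproj x) e = 0.
Proof.
move=> eF; rewrite innerBl inner_suml (bigD1_seq e) //=.
rewrite innerZl (bO.1 e e (Fb eF) (Fb eF)) eqxx mulr1 big1_seq ?addr0 ?subrr //
  => f.
by move=> /andP[fe fF]; rewrite innerZl (bO.1 f e (Fb fF) (Fb eF)) (negbTE fe)
  mulr0.
Qed.

Lemma ri_fproj x : ri x (fproj x) = \sum_(e <- F) sqcoef x e.
Proof. by rewrite ri_sumr; apply: eq_bigr => e _; rewrite ri_proj. Qed.

Lemma fproj_ortho_proj x y : ri (x - fproj x) (fproj y) = 0.
Proof.
rewrite ri_sumr big1_seq // => e /andP[_ eF].
have [h1 h2] := inner_eq0 (fproj_ortho x eF).
set u := x - _ in h1 h2 *.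
by rewrite riC riZlE (riC e u) h1 (riC e) ri_il h2 oppr0 !mulr0 subr0.
Qed.

Lemma ri_fproj2 x : ri (x - fproj x) (x - fproj x) =
  ri x x - \sum_(e <- F) sqcoef x e.
Proof.
rewrite riDr riNr fproj_ortho_proj subr0 riDl riNl (riC _ x).
by rewrite ri_fproj.
Qed.
End FiniteProjection.

(** One inequality is Bessel's. For the other, Riesz on the span of b gives z in its closure with x
    - z orthogonal to b, so x = z by completeness of b; thus x is approximated from finite spans,
    and its projections do at least as well. *)
Lemma parseval b x : orthonormal_basis b ->
  (\esum_(e in b) (sqcoef x e)%:E = (ri x x)%:E)%E.
Proof.
move=> bO; apply/eqP; rewrite eq_le; apply/andP; split.
  apply: esum_le_seq => F uF Fb.
  by rewrite -subr_ge0 -(ri_fproj2 bO uF Fb) ri_ge0.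
(* The finite span of b, expressed by double orthogonality so that no coefficients are carried
   along. *)
pose V y := exists F : seq H, (forall e, e \in F -> b e) /\
  forall u, (forall e, e \in F -> inner u e = 0) -> inner u y = 0.
have Vb e c : b e -> V (c *: e).
  move=> be; exists [:: e]; split=> [f|u h]; first by rewrite inE => /eqP ->.
  by rewrite innerZr h ?mulr0 // inE.
have [||||||z [zV hz]] := @riesz_real _ _ V (fun y => ri y x) (nm x).
- by exists [::]; split=> // u _; rewrite linear0r.
- move=> y y' [F [Fb hF]] [F' [Fb' hF']]; exists (F ++ F'); split.
    by move=> e; rewrite mem_cat => /orP[/Fb|/Fb'].
  move=> u h; rewrite innerDr hF ?hF' ?addr0 // => e eF; apply: h;
    by rewrite mem_cat eF ?orbT.
- move=> a y [F [Fb hF]]; exists F; split=> // u /hF h.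
  by rewrite innerZr h mulr0.
- by move=> y y'; rewrite riE.
- by move=> a y; rewrite riE.
- by move=> y; rewrite mulrC ri_le.
have xz : x = z.
  apply/eqP; rewrite -subr_eq0; apply/eqP/bO.2 => e be.
  have h c : ri (x - z) (c *: e) = 0.
    by rewrite riC !riE hz ?subrr //; exact: Vb.
  rewrite innerRI h; congr (_ +i* _).
  by have := h 1; rewrite scale1r.
apply/lee_addgt0Pr => eps eps0.
have s0 : 0 < Num.sqrt eps by rewrite sqrtr_gt0.
have [y [F [Fb hF]]] := zV _ s0; rewrite -xz => hy.
have uF := undup_uniq F.
have Fb' e : e \in undup F -> b e by rewrite mem_undup => /Fb.
apply: le_trans (leeD2r _ (esum_ge_seq (sqcoef x) uF Fb')).
rewrite -EFinD lee_fin -lerBlDl -(ri_fproj2 bO uF Fb').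
set p := fproj _ x.
have h1 : ri (x - p) y = 0.
  suff h : inner (x - p) y = 0 by rewrite /ri h.
  by apply: hF => e eF; apply: (fproj_ortho bO) => //; rewrite mem_undup.
have h2 : ri (x - p) p = 0 := fproj_ortho_proj bO uF Fb' x x.
(* Pythagoras: the projection p is at least as close to x as the approximant y. *)
have h3 : ri (x - y) (x - y) = ri (x - p) (x - p) + ri (p - y) (p - y).
  have -> : x - y = (x - p) + (p - y) by rewrite addrA subrK.
  rewrite riDl !(riDr _ (x - p) (p - y)) (riC (p - y) (x - p)).
  by rewrite (riDr (x - p) p) riNr h1 h2; lra.
apply: (@le_trans _ _ (ri (x - y) (x - y))).
  by rewrite h3 lerDl ri_ge0.
rewrite ri_nm -(sqr_sqrtr (ltW eps0)) ler_sqr ?nnegrE ?nm_ge0 //.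
Qed.

Lemma sqcoef_adjoint A B x y : linear B ->
  (forall u v, ri (A u) v = ri u (B v)) -> sqcoef (A x) y = sqcoef (B y) x.
Proof.
move=> lB h; rewrite /sqcoef !h (linearZ_op _ _ lB) (riC x (B y)).
by rewrite (riC x) ri_il sqrrN.
Qed.

(* The square of the Hilbert-Schmidt norm of A, possibly infinite. *)
Definition hs b A : \bar R := \esum_(e in b) (ri (A e) (A e))%:E.

(** By Parseval both sides are the double sum of |<A e, f>|^2, taken in either order. With A = B
    Hermitian this is independence of the basis. *)
Lemma hs_adjoint b b' A B :
  orthonormal_basis b -> orthonormal_basis b' -> linear B ->
  (forall u v, ri (A u) v = ri u (B v)) -> hs b A = hs b' B.
Proof.
move=> bO bO' lB h.
transitivity (\esum_(e in b) \esum_(f in b') (sqcoef (A e) f)%:E)%E.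
  by apply: eq_esum => e _; rewrite parseval.
rewrite exchange_esum; last by move=> e f; rewrite lee_fin sqcoef_ge0.
apply: eq_esum => f _; rewrite -(parseval _ bO).
by apply: eq_esum => e _; rewrite (sqcoef_adjoint _ _ lB h).
Qed.

Lemma hs_ge0 b A : (0 <= hs b A)%E.
Proof. by apply: esum_ge0 => e _; rewrite lee_fin ri_ge0. Qed.

Lemma hs_compl b A B : bounded_op B -> (hs b A < +oo)%E ->
  (hs b (B \o A) < +oo)%E.
Proof.
move=> /bounded_opP[lB [M M0 hM]] h.
have hle : (hs b (B \o A) <= (M ^+ 2)%:E * hs b A)%E.
  have hfin : hs b A \is a fin_num by rewrite ge0_fin_numE ?hs_ge0.
  rewrite -(fineK hfin) -EFinM; apply: esum_le_seq => r ur rb.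
  apply: (@le_trans _ _ (M ^+ 2 * \sum_(e <- r) ri (A e) (A e))).
    rewrite mulr_sumr; apply: ler_sum => e _; rewrite !ri_nm -exprMn.
    by rewrite ler_sqr ?nnegrE ?mulr_ge0 ?nm_ge0 //; exact: hM.
  rewrite ler_wpM2l ?sqr_ge0 // -lee_fin fineK //.
  exact: esum_ge_seq.
apply: le_lt_trans hle _; apply: lte_mul_pinfty => //.
by rewrite lee_fin sqr_ge0.
Qed.
End Parseval.

(** * Unconditional sums over a basis *)

Section BasisSums.
Context {R : realType} {H : hilbertType R}.
Implicit Types (x y z e : H) (a : R) (c : R[i]) (A B D P : H -> H) (b : set H).
Implicit Types (g : H -> R).

Existing Instance totally_filter.

(** Finite subsets of all of H, with terms off b set to 0, mirror the net in [trace]. *)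
Definition bsum b g (F : {fset H}) : R :=
  \sum_(e <- F) (if e \in b then g e else 0).

Definition bsum_cvg b g (s : R) : Prop := bsum b g @ totally --> s.

Lemma bsum_cvg_unique b g s s' : bsum_cvg b g s -> bsum_cvg b g s' -> s = s'.
Proof. by move=> h h'; exact: cvg_unique h h'. Qed.

Lemma bsum_cvg_ext b g g' s : (forall e, b e -> g e = g' e) ->
  bsum_cvg b g s -> bsum_cvg b g' s.
Proof.
move=> h; rewrite /bsum_cvg; suff -> : bsum b g' = bsum b g by [].
by apply/funext => F; apply: eq_bigr => e _; case: ifP => // /[!inE] /h.
Qed.

Lemma bsum_cvgD b g g' s s' : bsum_cvg b g s -> bsum_cvg b g' s' ->
  bsum_cvg b (fun e => g e + g' e) (s + s').
Proof.
move=> h h'; rewrite /bsum_cvg.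
have -> : bsum b (fun e => g e + g' e) = bsum b g \+ bsum b g';
  last exact: cvgD.
apply/funext => F; rewrite /bsum /= -big_split /=.
by apply: eq_bigr => e _; case: ifP => // _; rewrite addr0.
Qed.

Lemma bsum_cvgZ b g s a : bsum_cvg b g s -> bsum_cvg b (fun e =>
  a * g e) (a * s).
Proof.
move=> h; rewrite /bsum_cvg.
have -> : bsum b (fun e => a * g e) = cst a \* bsum b g.
  apply/funext => F; rewrite /bsum /= mulr_sumr.
  by apply: eq_bigr => e _; case: ifP => // _; rewrite mulr0.
by apply: cvgM h; exact: cvg_cst.
Qed.

Lemma bsum_cvgB b g g' s s' : bsum_cvg b g s -> bsum_cvg b g' s' ->
  bsum_cvg b (fun e => g e - g' e) (s - s').
Proof.
move=> h h0; have h' := bsum_cvgZ (a := -1) h0.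
rewrite -(mulN1r s').
by apply: bsum_cvg_ext (bsum_cvgD h h') => e _; rewrite mulN1r.
Qed.

Lemma bsum_cvg0 b : bsum_cvg b (fun=> 0) 0.
Proof.
rewrite /bsum_cvg; have -> : bsum b (fun=> 0) = fun=> 0.
  by apply/funext => F; rewrite /bsum big1 // => e _; case: ifP.
exact: cvg_cst.
Qed.

Lemma bsum_cvg_sum b (I : Type) (r : seq I) (g : I -> H -> R) (s : I -> R) :
  (forall i, bsum_cvg b (g i) (s i)) ->
  bsum_cvg b (fun e => \sum_(i <- r) g i e) (\sum_(i <- r) s i).
Proof.
move=> h; elim: r => [|i r IH].
  by rewrite big_nil; apply: bsum_cvg_ext (bsum_cvg0 b) => e _; rewrite big_nil.
rewrite big_cons; apply: bsum_cvg_ext (bsum_cvgD (h i) IH) => e _.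
by rewrite big_cons.
Qed.

Lemma bsum_mono b g (F G : {fset H}) : (forall e, b e -> 0 <= g e) ->
  (F `<=` G)%fset -> bsum b g F <= bsum b g G.
Proof.
move=> g0 /fsubsetP FG; rewrite /bsum.
rewrite [leRHS](big_fsetID _ (mem F)) /=.
have -> : [fset x | x in G & x \in F]%fset = F.
  apply/fsetP => e; rewrite !inE /= andbC.
  by case eF : (e \in F) => //=; rewrite FG.
rewrite lerDl; apply: sumr_ge0 => e _; case: ifP => // /[!inE] be.
exact: g0.
Qed.

Lemma bsum_le_esum b g (F : {fset H}) : (forall e, b e -> 0 <= g e) ->
  ((bsum b g F)%:E <= \esum_(e in b) (g e)%:E)%E.
Proof.
move=> g0; rewrite /bsum -big_mkcond /= -big_filter.
apply: esum_ge_seq; first by rewrite filter_uniq // fset_uniq.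
by move=> e; rewrite mem_filter => /andP[/set_mem].
Qed.

Lemma bsum_cvg_esum b g (s : R) : (forall e, b e -> 0 <= g e) ->
  (\esum_(e in b) (g e)%:E = s%:E)%E -> bsum_cvg b g s.
Proof.
move=> g0 hs; apply/cvgrPdist_le => eps e0.
have : ((s - eps)%:E < \esum_(e in b) (g e)%:E)%E.
  by rewrite hs lte_fin gtrDl oppr_lt0.
move=> /ereal_sup_gt[_ [X [fX Xb] <-]].
rewrite fsbig_finite // sumEFin lte_fin => hX.
exists (fset_set X) => // G /= XG.
have : bsum b g (fset_set X) <= bsum b g G by exact: bsum_mono.
have -> : bsum b g (fset_set X) = \sum_(i <- fset_set X) g i.
  apply: eq_big_seq => e; rewrite in_fset_set // inE => /Xb be.
  by rewrite ifT // inE.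
have := bsum_le_esum G g0; rewrite hs lee_fin => h1 h2.
by rewrite ger0_norm ?subr_ge0 //; lra.
Qed.

Lemma bsum_cvg_ge0 b g s : (forall e, b e -> 0 <= g e) -> bsum_cvg b g s ->
  0 <= s.
Proof.
move=> g0 h; rewrite -(cvg_lim _ h) //; apply: limr_ge.
  by apply/cvg_ex; exists s.
by apply: nearW => F; apply: sumr_ge0 => e _; case: ifP => // /[!inE] /g0.
Qed.

Lemma bsum_cvg_ub b g s (F : {fset H}) : (forall e, b e -> 0 <= g e) ->
  bsum_cvg b g s ->
  bsum b g F <= s.
Proof.
move=> g0 h; rewrite -(cvg_lim _ h) //; apply: limr_ge.
  by apply/cvg_ex; exists s.
by exists F => // G /= FG; exact: bsum_mono.
Qed.

Lemma bsum_cvg_eq0 b g : (forall e, b e -> 0 <= g e) -> bsum_cvg b g 0 ->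
  forall e, b e -> g e = 0.
Proof.
move=> g0 h e be; apply/eqP; rewrite eq_le g0 // andbT.
have := bsum_cvg_ub [fset e]%fset g0 h.
by rewrite /bsum big_seq_fset1 ifT // inE.
Qed.

Definition trace_net A b : {fset H} -> R[i]^o :=
  partial_sum (fun e : H => if e \in b then inner (A e) e else 0).

Lemma trace_netE A b F : trace_net A b F =
  (bsum b (fun e => ri (A e) e) F) +i* (bsum b (fun e => ri (A e) ('i *: e)) F).
Proof.
rewrite /trace_net /partial_sum -(big_seq_fsetE _ F xpredT
  (fun e => if e \in b then inner (A e) e else 0)) /bsum /=.
elim/big_rec3: _ => // e u v w _ ->.
by case: ifP => _; rewrite ?innerRI // !add0r.
Qed.

Lemma norm2_le (u v : R) : Num.sqrt (u ^+ 2 + v ^+ 2) <= `|u| + `|v|.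
Proof.
rewrite -[leRHS]ger0_norm ?addr_ge0 // -sqrtr_sqr ler_wsqrtr //.
rewrite sqrrD !real_normK ?num_real // lerD2r lerDl.
by rewrite mulrn_wge0 // mulr_ge0.
Qed.

Lemma trace_net_cvg A b (s : R) :
  bsum_cvg b (fun e => ri (A e) e) s ->
  bsum_cvg b (fun e => ri (A e) ('i *: e)) 0 ->
  trace_net A b @ totally --> (s%:C : R[i]^o).
Proof.
move=> h1 h2; apply/cvgrPdist_le => eps e0.
have e0' : 0 < complex.Re eps / 2 by move: e0; rewrite ltcE => /andP[_ ?];
  rewrite divr_gt0.
have eE : eps = (complex.Re eps)%:C by rewrite RRe_real // gtr0_real.
move/cvgrPdist_le : h1 => /(_ _ e0') h1;
  move/cvgrPdist_le : h2 => /(_ _ e0') h2.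
near=> F; rewrite trace_netE eE normc_def lecR /=.
apply: le_trans (norm2_le _ _) _; rewrite sub0r normrN [leRHS]splitr lerD //.
  by near: F.
rewrite -normrN -(add0r (- _)); near: F; exact: h2.
Unshelve. all: by end_near.
Qed.

(** A basis must exist here: without one, every number would be a common value over all bases and
    [xget] could return any of them. *)
Lemma trace_eq A (s : R) : (exists b, @orthonormal_basis R H b) ->
  (forall b, orthonormal_basis b ->
    bsum_cvg b (fun e => ri (A e) e) s /\
    bsum_cvg b (fun e => ri (A e) ('i *: e)) 0) ->
  Tr A = s.
Proof.
move=> [b0 bO0] h; rewrite /Tr /trace.
rewrite (@xget_subset1 _ _ _ (s%:C)) //.
  by move=> b bO; apply: trace_net_cvg; have [] := h b bO.
move=> t u /(_ b0 bO0) ht /(_ b0 bO0) hu.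
exact: (@cvg_unique R[i]^o _ _ _ t u ht hu).
Qed.

End BasisSums.

(** * Trace-class operators and traces *)

Section TraceClass.
Context {R : realType} {H : hilbertType R}.
Implicit Types (x y z e : H) (a : R) (c : R[i]) (A B D P S : H ->
  H) (b : set H).

Definition fintr b A : Prop :=
  psd_op A /\ (\esum_(e in b) (ri (A e) e)%:E < +oo)%E.

Lemma fintr_psd b A : fintr b A -> psd_op A.
Proof. by case. Qed.

Lemma fintr_sqrt b A : fintr b A ->
  exists S, [/\ psd_op S, forall x, S (S x) = A x & (hs b S < +oo)%E].
Proof.
move=> [pA fA]; have [S [pS SS _]] := psd_sqrt pA; exists S; split=> //.
rewrite /hs (eq_esum (b := fun e => (ri (A e) e)%:E)) // => e _.
by rewrite -SS (hermitian_ri (S _) _ (psd_op_hermitian pS)).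
Qed.

Lemma hs_fintr b A S : psd_op A -> (forall x, ri (A x) x = ri (S x) (S x)) ->
  (hs b S < +oo)%E -> fintr b A.
Proof. by move=> pA h hS; split=> //; under eq_esum do rewrite h. Qed.

Lemma hs_hermitian b b' S : orthonormal_basis b -> orthonormal_basis b' ->
  hermitian_op S -> hs b S = hs b' S.
Proof.
move=> bO bO' hS; apply: (hs_adjoint bO bO' (hermitian_op_linear hS)) => u v.
exact: hermitian_ri.
Qed.

(** The trace of A = S^2 is the squared Hilbert-Schmidt norm of the Hermitian operator S, which is
    the same in every basis. *)
Lemma fintr_basis b b' A : orthonormal_basis b -> orthonormal_basis b' ->
  fintr b A -> fintr b' A.
Proof.
move=> bO bO' fA; have [S [pS SS hS]] := fintr_sqrt fA.
apply: (@hs_fintr _ _ S (fintr_psd fA)).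
  by move=> x; rewrite -SS (hermitian_ri _ _ (psd_op_hermitian pS)).
by rewrite -(hs_hermitian bO bO') //; exact: psd_op_hermitian.
Qed.

Lemma fintr0 b : fintr b (0 : H -> H).
Proof.
by split; [exact: psd_op0|rewrite esum1 ?ltry // => e _; rewrite ri0l].
Qed.

Lemma fintrD b A B : fintr b A -> fintr b B -> fintr b (A + B).
Proof.
move=> [pA fA] [pB fB]; split; first exact: psd_opD.
under eq_esum do rewrite fctE riDl EFinD.
rewrite esumD ?lte_add_pinfty // => e _; rewrite lee_fin; exact: psd_op_ge0.
Qed.

Lemma fintr_le b A B : psd_op B -> (forall x, ri (B x) x <= ri (A x) x) ->
  fintr b A -> fintr b B.
Proof.
move=> pB h [pA fA]; split=> //; apply: le_lt_trans fA.
by apply: le_esum => e _; rewrite lee_fin.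
Qed.

(** The trace of D S S D is the squared Hilbert-Schmidt norm of S D, hence of its adjoint D S, and D
    is bounded. *)
Lemma fintr_sandwich b A D : orthonormal_basis b -> fintr b A ->
  hermitian_op D -> fintr b (D \o A \o D).
Proof.
move=> bO fA hD; have [S [pS SS hS]] := fintr_sqrt fA.
have hSh := psd_op_hermitian pS.
apply: (@hs_fintr _ _ (S \o D)).
- by apply: psd_op_sandwich => //; exact: fintr_psd fA.
- by move=> x /=; rewrite (hermitian_ri _ x hD) -SS (hermitian_ri (S _) _ hSh).
have -> : hs b (S \o D) = hs b (D \o S).
  apply: (hs_adjoint bO bO); last first.
    by move=> u v /=; rewrite (hermitian_ri _ _ hSh) (hermitian_ri _ _ hD).
  by apply/bounded_op_linear/bounded_op_comp; exact: hermitian_op_bounded.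
by apply: hs_compl => //; exact: hermitian_op_bounded.
Qed.

(** A special sandwich, by the scalar operator sqrt a. *)
Lemma fintrZ b a A : 0 <= a -> orthonormal_basis b -> fintr b A ->
  fintr b (a%:C *: A).
Proof.
move=> a0 bO fA; have h := hermitian_opZ (Num.sqrt a) (@hermitian_op_id R H).
apply: (fintr_le _ _ (fintr_sandwich bO fA h)) => [|x].
  by apply: psd_opZ => //; exact: fintr_psd fA.
have lA := hermitian_op_linear (psd_op_hermitian (fintr_psd fA)).
rewrite /= !fctE (linearZ_op _ _ lA) !riE mulrA -expr2 sqr_sqrtr //.
Qed.

(* By [trace_class_htc] and [htc_trace_class] below, these are exactly the
   Hermitian trace-class operators. *)
Definition htc b A : Prop :=
  exists A1 A2, [/\ fintr b A1, fintr b A2 & A = A1 - A2].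

Lemma htc_hermitian b A : htc b A -> hermitian_op A.
Proof.
by move=> [A1 [A2 [[p1 _] [p2 _] ->]]]; apply: hermitian_opB;
  exact: psd_op_hermitian.
Qed.

Lemma fintr_htc b A : fintr b A -> htc b A.
Proof. by move=> fA; exists A, 0; split; rewrite ?subr0 //; exact: fintr0. Qed.

Lemma htc0 b : htc b (0 : H -> H).
Proof. exact/fintr_htc/fintr0. Qed.

Lemma htcD b A B : htc b A -> htc b B -> htc b (A + B).
Proof.
move=> [A1 [A2 [f1 f2 ->]]] [B1 [B2 [g1 g2 ->]]].
exists (A1 + B1), (A2 + B2); split; [exact: fintrD..|].
by rewrite opprD addrACA.
Qed.

Lemma htcN b A : htc b A -> htc b (- A).
Proof. by move=> [A1 [A2 [f1 f2 ->]]]; exists A2, A1; split;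
  rewrite ?opprB. Qed.

Lemma htcB b A B : htc b A -> htc b B -> htc b (A - B).
Proof. by move=> hA hB; apply/htcD/htcN. Qed.

Lemma htcZ b a A : orthonormal_basis b -> htc b A -> htc b (a%:C *: A).
Proof.
move=> bO; wlog a0 : a A / 0 <= a => [hw|].
  have [/hw|/ltW an] := leP 0 a; first exact.
  move=> hA; have -> : a%:C *: A = (- a)%:C *: - A.
    by rewrite rmorphN /= scaleNr scalerN opprK.
  by apply: hw; [rewrite oppr_ge0|exact: htcN].
move=> [A1 [A2 [f1 f2 ->]]]; exists (a%:C *: A1), (a%:C *: A2).
by split; [exact: fintrZ..|rewrite scalerBr].
Qed.

Lemma htc_sum b (I : Type) (r : seq I) (F : I -> H -> H) :
  (forall i, htc b (F i)) -> htc b (\sum_(i <- r) F i).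
Proof. by move=> h; apply: big_ind => //; [exact: htc0|exact: htcD]. Qed.

Lemma htc_psd b A : psd_op A -> htc b A -> fintr b A.
Proof.
move=> pA [A1 [A2 [f1 [p2 _] eA]]]; apply: fintr_le f1 => // x.
by rewrite eA !fctE riDl riNl gerDl oppr_le0 psd_op_ge0.
Qed.

(** A D + D A = ((D + 1) A (D + 1) - (D - 1) A (D - 1)) / 2 reduces the anticommutator, the shape of
    the dual solution, to sandwiches. *)
Lemma htc_anticomm b A D : orthonormal_basis b -> htc b A -> hermitian_op D ->
  htc b ((A \o D) + (D \o A)).
Proof.
move=> bO [A1 [A2 [f1 f2 eA]]] hD.
have hp : hermitian_op (D + id) by apply: hermitian_opD => //;
  exact: hermitian_op_id.
have hm : hermitian_op (D - id) by apply: hermitian_opB => //;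
  exact: hermitian_op_id.
have key B : fintr b B -> htc b ((B \o D) + (D \o B)).
  move=> fB; have lB := hermitian_op_linear (psd_op_hermitian (fintr_psd fB)).
  have lD := hermitian_op_linear hD.
  have -> : (B \o D) + (D \o B) = (2^-1)%:C *:
      (((D + id) \o B \o (D + id)) - ((D - id) \o B \o (D - id))).
    apply/funext => x.
    transitivity ((2^-1)%:C *: ((D (B (D x + x)) + B (D x + x)) -
      (D (B (D x - x)) - B (D x - x)))); last by [].
    rewrite (linearB_op _ _ lB) (linearD_op _ _ lB).
    rewrite (linearB_op _ _ lD) (linearD_op _ _ lD).
    by apply: ri_ext => y; rewrite !fctE !riE /=; lra.
  apply: htcZ => //; apply: htcB; apply/fintr_htc; exact: fintr_sandwich.
have lD := hermitian_op_linear hD.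
have -> : (A \o D) + (D \o A) =
    ((A1 \o D) + (D \o A1)) - ((A2 \o D) + (D \o A2)).
  apply/funext => x.
  transitivity (A1 (D x) - A2 (D x) + D (A1 x - A2 x)); first by rewrite eA.
  rewrite (linearB_op _ _ lD).
  transitivity (A1 (D x) + D (A1 x) - (A2 (D x) + D (A2 x))); last by [].
  by apply: ri_ext => y; rewrite !riE; lra.
by apply: htcB; exact: key.
Qed.

End TraceClass.

(** * Comparing P and A when P^2 = A^2 *)

Section Trace.
Context {R : realType} {H : hilbertType R}.
Implicit Types (x y z e : H) (a : R) (c : R[i]) (A B D P S : H ->
  H) (b : set H).

(* If l < 0 is the infimum of the quadratic form of T = P - A, then W = T - l
   is psd, and 0 = |Px|^2 - |Ax|^2 forces W to be bounded below. *)
Lemma psd_ge_of_sq P A : psd_op P -> hermitian_op A ->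
  (forall x, ri (P x) (P x) = ri (A x) (A x)) ->
  forall x, ri (A x) x <= ri (P x) x.
Proof.
move=> pP hA hPA x0; rewrite leNgt; apply/negP => hx0.
have hP := psd_op_hermitian pP.
pose T := P - A; have TE x : T x = P x - A x by [].
have hT : hermitian_op T by exact: hermitian_opB.
have x00 : 0 < ri x0 x0.
  rewrite lt_neqAle ri_ge0 andbT eq_sym ri_eq0; apply/eqP => x00.
  by move: hx0; rewrite x00 !ri0r ltxx.
have [_ [N N0 hN]] := (bounded_opP T).1 (hermitian_op_bounded hT).
pose S : set R := [set l | forall x, l * ri x x <= ri (T x) x].
have ub : ubound S (ri (T x0) x0 / ri x0 x0).
  by move=> l /(_ x0); rewrite ler_pdivlMr.
have hS : has_sup S.
  split; last by exists (ri (T x0) x0 / ri x0 x0).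
  exists (- N) => x; rewrite mulNr lerNl -riNl.
  apply: le_trans (ri_le _ _) _; rewrite nmN ri_nm expr2 mulrA.
  by rewrite ler_wpM2r ?nm_ge0.
pose l := sup S.
have l0 : l < 0.
  apply: le_lt_trans (ge_sup hS.1 ub) _.
  by rewrite pmulr_llt0 ?invr_gt0 // TE riDl riNl subr_lt0.
have lS x : l * ri x x <= ri (T x) x.
  have [->|xn0] := eqVneq x 0; first by rewrite !ri0r mulr0.
  have xp : 0 < ri x x by rewrite lt_neqAle eq_sym ri_eq0 xn0 ri_ge0.
  rewrite -ler_pdivlMr //; apply: ge_sup; first by case: hS.
  by move=> k /(_ x); rewrite ler_pdivlMr.
pose W := T - l%:C *: id; have WE x : W x = T x - l%:C *: x by [].
have pW : psd_op W.
  apply/psd_opP; split=> [|x].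
    by apply: hermitian_opB => //; apply: hermitian_opZ; exact: hermitian_op_id.
  by rewrite WE riDl riNl riZl subr_ge0.
have [M M0 hM] := psd_op_bound pW.
have [_ [C C0 hC]] := (bounded_opP P).1 (hermitian_op_bounded hP).
pose K := C - l.
have K0 : 0 < K by rewrite /K; lra.
(* Expand |P x|^2 = |A x|^2 with A = P - W - l. The term 2 l <P x, x> is nonpositive, -|W x|^2 has
   the good sign, and K = C - l collects the bounds on <P x, W x> and <W x, x>. *)
have est x : l ^+ 2 * nm x <= 2 * K * nm (W x).
  have [->|xn0] := eqVneq x 0.
    by rewrite nm0 mulr0 !mulr_ge0 ?nm_ge0 // ltW.
  have xp : 0 < nm x by rewrite lt_neqAle eq_sym nm_eq0 xn0 nm_ge0.
  rewrite -(ler_pM2r xp).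
  have AE : A x = P x - W x - l%:C *: x.
    by apply: ri_ext => y; rewrite WE TE !riE; lra.
  have := hPA x; rewrite AE; move: (W x) => w.
  rewrite !riE (riC w (P x)) (riC x (P x)) (riC x w) => h.
  have h1 := psd_op_ge0 x pP.
  have h2 := ri_ge0 w.
  have h3 : ri (P x) w <= C * nm x * nm w.
    by apply: le_trans (ri_le _ _) _; rewrite ler_wpM2r ?nm_ge0.
  have h4 := ri_le w x.
  have h5 : l * ri (P x) x <= 0 by rewrite nmulr_rle0.
  have h6 : - l * ri w x <= - l * (nm w * nm x).
    by rewrite ler_wpM2l // oppr_ge0 ltW.
  have h7 : l ^+ 2 * nm x * nm x = l * (l * ri x x) by rewrite ri_nm; ring.
  rewrite h7 /K; nra.
have est2 x : l ^+ 4 * ri x x <= 4 * K ^+ 2 * M * ri (W x) x.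
  move: (est x) (psd_op_norm_sq x pW hM); move: (W x) => w e1 e2.
  apply: (@le_trans _ _ (4 * K ^+ 2 * ri w w)); last first.
    by rewrite -[leRHS]mulrA ler_pM2l // mulr_gt0 // exprn_gt0.
  have -> : l ^+ 4 * ri x x = (l ^+ 2 * nm x) ^+ 2 by rewrite ri_nm; ring.
  have -> : 4 * K ^+ 2 * ri w w = (2 * K * nm w) ^+ 2 by rewrite ri_nm; ring.
  have p1 : 0 <= l ^+ 2 * nm x by rewrite mulr_ge0 ?nm_ge0 ?sqr_ge0.
  by rewrite ler_sqr ?nnegrE // (le_trans p1).
have q0 : 0 < 4 * K ^+ 2 * M by rewrite !mulr_gt0 // exprn_gt0.
(* Since |W x|^2 <= M <W x, x>, the estimate turns into W >= c; then l + c is still a lower bound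
   for the form of T, against the choice of l. *)
pose c := l ^+ 4 / (4 * K ^+ 2 * M).
have c0 : 0 < c by rewrite divr_gt0 // exprn_even_gt0 //= lt_eqF.
have : l + c <= l.
  apply: ub_le_sup; first by case: hS.
  move=> x; have : c * ri x x <= ri (W x) x.
    by rewrite /c mulrAC ler_pdivrMr // [leRHS]mulrC est2.
  by rewrite WE riDl riNl riZl mulrDl; lra.
by rewrite gerDl leNgt c0.
Qed.
End Trace.

(** * Trace formulas through square roots *)

Section TraceFormulas.
Context {R : realType} {H : hilbertType R}.
Implicit Types (x y z e : H) (a : R) (c : R[i]) (A B D P S : H ->
  H) (b : set H).

(** A = (|A| + A)/2 - (|A| - A)/2, where both parts lie between 0 and |A| by [psd_ge_of_sq] for A
    and for -A. *)
Lemma trace_class_htc b A : orthonormal_basis b -> hermitian_op A ->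
  trace_class A -> htc b A.
Proof.
move=> bO hA [_ [P [b' [[pP PE] bO' fP]]]].
have fP' : fintr b P by apply: (fintr_basis bO' bO); split.
have hP := psd_op_hermitian pP.
have PA x : ri (P x) (P x) = ri (A x) (A x).
  by rewrite -(hermitian_ri (P x) x hP) /ri PE.
have le1 := psd_ge_of_sq pP hA PA.
have le2 x : - ri (A x) x <= ri (P x) x.
  have := @psd_ge_of_sq _ _ P (- A) pP (hermitian_opN hA) _ x.
  rewrite !fctE riNl; apply => y.
  by rewrite !riE opprK PA.
have half0 : (0 : R) <= 2^-1 by lra.
have lA := hermitian_op_linear hA.
exists ((2^-1)%:C *: (P + A)), ((2^-1)%:C *: (P - A)); split.
- apply: fintr_le fP' => [|x].
    apply: psd_opZ => //; apply/psd_opP; split; first exact: hermitian_opD.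
    by move=> x; have := le2 x; rewrite !fctE riDl; lra.
  by have := le1 x; rewrite !fctE riZl riDl; lra.
- apply: fintr_le fP' => [|x].
    apply: psd_opZ => //; apply/psd_opP; split; first exact: hermitian_opB.
    by move=> x; have := le1 x; rewrite !fctE riDl riNl; lra.
  by have := le2 x; rewrite !fctE riZl riDl riNl; lra.
- apply/funext => x.
  transitivity ((2^-1)%:C *: (P x + A x) - (2^-1)%:C *: (P x - A x));
    last by [].
  by apply: ri_ext => y; rewrite !riE; lra.
Qed.

Lemma hermitian_im0 D y : hermitian_op D -> ri (D y) ('i *: y) = 0.
Proof.
move=> hD; have lD := hermitian_op_linear hD.
have : ri (D y) ('i *: y) = - ri (D y) ('i *: y).
  by rewrite -ri_il -(linearZ_op _ _ lD) (hermitian_ri _ _ hD) riC.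
by lra.
Qed.

Lemma hs_bsum b (T : H -> H) : (hs b T < +oo)%E ->
  bsum_cvg b (fun e => ri (T e) (T e)) (fine (hs b T)).
Proof.
move=> h; apply: bsum_cvg_esum => [e _|]; first exact: ri_ge0.
by rewrite fineK // ge0_fin_numE // hs_ge0.
Qed.

(* By polarisation the sums over any two bases reduce to Hilbert-Schmidt norms
   of S (D + c) and of its adjoint, for c = 1, -1, i, -i. *)
Lemma sq_trace_cvg b S D : orthonormal_basis b -> psd_op S ->
  (hs b S < +oo)%E -> hermitian_op D ->
  exists q : R, bsum_cvg b (fun f => ri (D (S f)) (S f)) q /\
   forall b', orthonormal_basis b' ->
    bsum_cvg b' (fun e => ri (S (S (D e))) e) q /\
    bsum_cvg b' (fun e => ri (S (S (D e))) ('i *: e)) 0.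
Proof.
move=> bO pS fS hD; have hS := psd_op_hermitian pS.
have lS := hermitian_op_linear hS; have lD := hermitian_op_linear hD.
pose Dc c x := D x + c *: x.
have bDc c : bounded_op (Dc c).
  exact: (bounded_opD (hermitian_op_bounded hD) (bounded_opZ c (@bounded_op_id
    _ H))).
pose N c := fine (hs b (Dc c \o S)).
have Nb c : bsum_cvg b (fun f => ri (D (S f) + c *: S f) (D (S f) + c *:
  S f)) (N c).
  exact/(hs_bsum (T := Dc c \o S))/hs_compl.
have Nb' c b' : orthonormal_basis b' ->
    bsum_cvg b' (fun e => ri (S (D e) + c *: S e) (S (D e) + c *: S e)) (N c^*).
  move=> bO'.
  have E : hs b' (S \o Dc c) = hs b (Dc c^* \o S).
    apply: (hs_adjoint bO' bO).
      exact/bounded_op_linear/bounded_op_comp/hermitian_op_bounded.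
    move=> u v; rewrite /= /Dc (linearD_op _ _ lS) (linearZ_op _ _ lS) !riE.
    by rewrite (hermitian_ri _ _ hS) (hermitian_ri _ _ hD) ri_conjZ
      -(linearZ_op _ _ lS) (hermitian_ri _ _ hS) (linearZ_op _ _ lS).
  rewrite /N -E.
  have /hs_bsum : (hs b' (S \o Dc c) < +oo)%E by rewrite E hs_compl.
  by apply: bsum_cvg_ext => e _; rewrite /= /Dc (linearD_op _ _ lS) (linearZ_op
    _ _ lS).
(* The sign of c only affects the cross term 2 Re <D S f, c S f>, which is 0 for c = i as D is
   Hermitian. Hence the imaginary part of the trace vanishes. *)
have NN : N 'i = N (- 'i).
  apply: (bsum_cvg_unique (Nb 'i)); apply: bsum_cvg_ext (Nb (- 'i)) => f _.
  have h := hermitian_im0 (S f) hD.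
  by rewrite scaleNr !riE (riC ('i *: S f)) h; lra.
exists (4^-1 * (N 1 - N (-1))); split.
  apply: bsum_cvg_ext (bsum_cvgZ (a := 4^-1) (bsum_cvgB (Nb 1) (Nb (-1)))) =>
    f _.
  by rewrite scaleN1r scale1r !riE (riC (S f) (D (S f))); lra.
move=> b' bO'; split.
  have := bsum_cvgZ (a := 4^-1) (bsum_cvgB (Nb' 1 _ bO') (Nb' (-1) _ bO')).
  rewrite rmorphN !rmorph1; apply: bsum_cvg_ext => e _.
  rewrite (hermitian_ri (S (D e)) e hS) scaleN1r scale1r !riE.
  by rewrite (riC (S e) (S (D e))); lra.
have := bsum_cvgZ (a := 4^-1) (bsum_cvgB (Nb' 'i _ bO') (Nb' (- 'i) _ bO')).
have Ei : ('i)^* = - 'i :> R[i].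
  by apply/eqP; rewrite eq_complex /= oppr0 !eqxx.
have EiN : (- 'i)^* = 'i :> R[i].
  by apply/eqP; rewrite eq_complex /= oppr0 opprK !eqxx.
rewrite Ei EiN NN subrr mulr0; apply: bsum_cvg_ext => e _.
rewrite (hermitian_ri (S (D e)) _ hS) (linearZ_op _ _ lS) scaleNr !riE.
by rewrite (riC ('i *: S e) (S (D e))); lra.
Qed.
End TraceFormulas.

(** * Linearity, positivity and weak continuity of the trace *)

Section TraceAlgebra.
Context {R : realType} {H : hilbertType R} {b : set H}.
Hypothesis bO : orthonormal_basis b.
Implicit Types (x y z e v : H) (a : R) (c : R[i]) (A B D P S : H -> H).

Existing Instance totally_filter.

(** The passage from the definition of [trace] to sums over the fixed basis b; the linearity rules
    below follow by uniqueness of limits. *)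
Lemma Tr_cvg A D : htc b A -> hermitian_op D ->
  bsum_cvg b (fun e => ri (A (D e)) e) (Tr (A \o D)).
Proof.
move=> [A1 [A2 [f1 f2 ->]]] hD.
have [S1 [pS1 SS1 fS1]] := fintr_sqrt f1.
have [S2 [pS2 SS2 fS2]] := fintr_sqrt f2.
have [q1 [_ h1]] := sq_trace_cvg bO pS1 fS1 hD.
have [q2 [_ h2]] := sq_trace_cvg bO pS2 fS2 hD.
have key b' : orthonormal_basis b' ->
    bsum_cvg b' (fun e => ri (((A1 - A2) \o D) e) e) (q1 - q2) /\
    bsum_cvg b' (fun e => ri (((A1 - A2) \o D) e) ('i *: e)) 0.
  move=> bO'; have [h1r h1i] := h1 b' bO'; have [h2r h2i] := h2 b' bO'.
  split; first apply: bsum_cvg_ext (bsum_cvgB h1r h2r) => e _.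
    by rewrite /= !fctE riDl riNl SS1 SS2.
  rewrite -[0]subr0; apply: bsum_cvg_ext (bsum_cvgB h1i h2i) => e _.
  by rewrite /= !fctE riDl riNl SS1 SS2.
rewrite (trace_eq _ key); last by exists b.
exact: (key b bO).1.
Qed.

(** A D need not be Hermitian, so <A D e, e> has no sign; in the form <D S f, S f> the positivity of
    D acts on each term. *)
Lemma Tr_sqrt A : fintr b A ->
  exists S, [/\ psd_op S, forall x, S (S x) = A x, (hs b S < +oo)%E &
    forall D, hermitian_op D ->
      bsum_cvg b (fun f => ri (D (S f)) (S f)) (Tr (A \o D))].
Proof.
move=> fA; have [S [pS SS fS]] := fintr_sqrt fA; exists S; split=> // D hD.
have [q [h1 /(_ b bO)[h2 _]]] := sq_trace_cvg bO pS fS hD.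
have h3 := Tr_cvg (fintr_htc fA) hD.
suff -> : Tr (A \o D) = q by [].
apply: bsum_cvg_unique h3 _; apply: bsum_cvg_ext h2 => e _.
by rewrite SS.
Qed.

Lemma TrDr A D D' : htc b A -> hermitian_op D -> hermitian_op D' ->
  Tr (A \o (D + D')) = Tr (A \o D) + Tr (A \o D').
Proof.
move=> hA hD hD'; have lA := hermitian_op_linear (htc_hermitian hA).
apply: bsum_cvg_unique (Tr_cvg hA (hermitian_opD hD hD')) _.
apply: bsum_cvg_ext (bsum_cvgD (Tr_cvg hA hD) (Tr_cvg hA hD')) => e _.
by rewrite !fctE (linearD_op _ _ lA) riDl.
Qed.

Lemma Tr0r A : htc b A -> Tr (A \o (0 : H -> H)) = 0.
Proof.
move=> hA; have lA := hermitian_op_linear (htc_hermitian hA).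
apply: bsum_cvg_unique (Tr_cvg hA hermitian_op0) _.
by apply: bsum_cvg_ext (bsum_cvg0 b) => e _; rewrite /= (linear0_op lA) ri0l.
Qed.

Lemma TrZr A D a : htc b A -> hermitian_op D ->
  Tr (A \o (a%:C *: D)) = a * Tr (A \o D).
Proof.
move=> hA hD; have lA := hermitian_op_linear (htc_hermitian hA).
apply: bsum_cvg_unique (Tr_cvg hA (hermitian_opZ a hD)) _.
apply: bsum_cvg_ext (bsum_cvgZ (a := a) (Tr_cvg hA hD)) => e _.
by rewrite !fctE (linearZ_op _ _ lA) riZl.
Qed.

Lemma TrNr A D : htc b A -> hermitian_op D -> Tr (A \o (- D)) = - Tr (A \o D).
Proof.
move=> hA hD; rewrite -mulN1r -TrZr //; congr (Tr (_ \o _)).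
by rewrite rmorphN rmorph1 scaleN1r.
Qed.

Lemma TrBr A D D' : htc b A -> hermitian_op D -> hermitian_op D' ->
  Tr (A \o (D - D')) = Tr (A \o D) - Tr (A \o D').
Proof. by move=> hA hD hD'; rewrite TrDr ?TrNr //; exact: hermitian_opN. Qed.

Lemma Tr_sumr A (I : Type) (r : seq I) (P : pred I) (F : I -> H -> H) :
  htc b A -> (forall i, hermitian_op (F i)) ->
  Tr (A \o (\sum_(i <- r | P i) F i)) = \sum_(i <- r | P i) Tr (A \o F i).
Proof.
move=> hA hF; elim: r => [|i r IH]; first by rewrite !big_nil Tr0r.
rewrite !big_cons; case: ifP => // _; rewrite TrDr ?IH //.
by apply: hermitian_op_sum => j _.
Qed.

Lemma TrDl A A' D : htc b A -> htc b A' -> hermitian_op D ->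
  Tr ((A + A') \o D) = Tr (A \o D) + Tr (A' \o D).
Proof.
move=> hA hA' hD; apply: bsum_cvg_unique (Tr_cvg (htcD hA hA') hD) _.
apply: bsum_cvg_ext (bsum_cvgD (Tr_cvg hA hD) (Tr_cvg hA' hD)) => e _.
by rewrite !fctE riDl.
Qed.

Lemma Tr0l D : hermitian_op D -> Tr ((0 : H -> H) \o D) = 0.
Proof.
move=> hD; apply: bsum_cvg_unique (Tr_cvg (htc0 b) hD) _.
by apply: bsum_cvg_ext (bsum_cvg0 b) => e _; rewrite /= ri0l.
Qed.

Lemma TrZl A D a : htc b A -> hermitian_op D ->
  Tr ((a%:C *: A) \o D) = a * Tr (A \o D).
Proof.
move=> hA hD; apply: bsum_cvg_unique (Tr_cvg (htcZ a bO hA) hD) _.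
apply: bsum_cvg_ext (bsum_cvgZ (a := a) (Tr_cvg hA hD)) => e _.
by rewrite !fctE riZl.
Qed.

Lemma TrBl A A' D : htc b A -> htc b A' -> hermitian_op D ->
  Tr ((A - A') \o D) = Tr (A \o D) - Tr (A' \o D).
Proof.
move=> hA hA' hD; apply: bsum_cvg_unique (Tr_cvg (htcB hA hA') hD) _.
apply: bsum_cvg_ext (bsum_cvgB (Tr_cvg hA hD) (Tr_cvg hA' hD)) => e _.
by rewrite !fctE riDl riNl.
Qed.

Lemma Tr_suml (I : Type) (r : seq I) (F : I -> H -> H) D :
  (forall i, htc b (F i)) -> hermitian_op D ->
  Tr ((\sum_(i <- r) F i) \o D) = \sum_(i <- r) Tr (F i \o D).
Proof.
move=> hF hD; elim: r => [|i r IH]; first by rewrite !big_nil Tr0l.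
by rewrite !big_cons TrDl ?IH //; exact: htc_sum.
Qed.

Lemma Tr_ge0 A D : htc b A -> psd_op A -> psd_op D -> 0 <= Tr (A \o D).
Proof.
move=> hA pA pD; have [S [_ _ _ h]] := Tr_sqrt (htc_psd pA hA).
by apply: bsum_cvg_ge0 (h _ (psd_op_hermitian pD)) => e _; exact: psd_op_ge0.
Qed.

(** All terms <D S e, S e> vanish, so D S kills the basis; taking adjoints, S D = 0 and A D = S S D
    = 0. *)
Lemma Tr_eq0 A D : htc b A -> psd_op A -> psd_op D -> Tr (A \o D) = 0 ->
  A \o D = 0.
Proof.
move=> hA pA pD h0; have [S [pS SS _ h]] := Tr_sqrt (htc_psd pA hA).
have hD := psd_op_hermitian pD; have hS := psd_op_hermitian pS.
have := h _ hD; rewrite h0 => /(bsum_cvg_eq0 (fun e _ => psd_op_ge0 _ pD)) h1.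
have DS f : b f -> D (S f) = 0.
  by move=> bf; apply: (psd_op_ker pD); exact: h1.
have lS := hermitian_op_linear hS; have lD := hermitian_op_linear hD.
apply/funext => x /=; rewrite -SS.
have -> : S (D x) = 0; last by rewrite (linear0_op lS).
apply: bO.2 => e be; rewrite innerRI.
have h2 c : ri (S (D x)) (c *: e) = 0.
  rewrite (hermitian_ri _ _ hS) (hermitian_ri _ _ hD) (linearZ_op _ _ lS).
  by rewrite (linearZ_op _ _ lD) DS // scaler0 ri0r.
by have := h2 1; rewrite scale1r h2 => ->.
Qed.

(** The operator |v><v| for v of any norm; it is a projection only if |v| is 0 or 1. *)
Definition rank1 v x : H := inner x v *: v.

Lemma ri_rank1E v x y :
  ri (rank1 v x) y = ri x v * ri y v + ri x ('i *: v) * ri y ('i *: v).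
Proof. by rewrite /rank1 riZlE innerRI /= (riC v y) (riC v) ri_il; ring. Qed.

Lemma ri_rank1 v x : ri (rank1 v x) x = sqcoef x v.
Proof. by rewrite riC ri_proj. Qed.

Lemma rank1_psd v : psd_op (rank1 v).
Proof.
apply/psd_opP; split; last by move=> x; rewrite ri_rank1 sqcoef_ge0.
apply/hermitian_opP; split.
  apply/bounded_opP; split.
    by move=> c x y; rewrite /rank1 linearPl scalerDl scalerA.
  (* The factor 2 comes from bounding the modulus of <x, v> by the sum of its real and imaginary
     parts. *)
  exists (2 * nm v ^+ 2); first by rewrite mulr_ge0 ?sqr_ge0.
  move=> x; rewrite nmZ innerRI normc_def /=.
  apply: (@le_trans _ _ ((nm x * nm v + nm x * nm v) * nm v)); last first.
    by rewrite le_eqVlt; apply/orP; left; apply/eqP; ring.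
  rewrite ler_wpM2r ?nm_ge0 // (le_trans (norm2_le _ _)) // lerD ?ri_abs_le //.
  by rewrite (le_trans (ri_abs_le _ _)) // nmZi.
by move=> x y; rewrite ri_rank1E [RHS]riC ri_rank1E; ring.
Qed.

(** For A = S^2 the sum over e of |<S e, v>|^2 = |<S v, e>|^2 is |S v|^2 by Parseval. *)
Lemma Tr_rank1 A v : htc b A -> Tr (A \o rank1 v) = ri (A v) v.
Proof.
have hv := psd_op_hermitian (rank1_psd v).
have key B : fintr b B -> Tr (B \o rank1 v) = ri (B v) v.
  move=> fB; have [S [pS SS _ h]] := Tr_sqrt fB.
  have hS := psd_op_hermitian pS.
  apply: bsum_cvg_unique (h _ hv) _.
  have h1 : bsum_cvg b (sqcoef (S v)) (ri (S v) (S v)).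
    by apply: bsum_cvg_esum => [e _|]; [exact: sqcoef_ge0|exact: parseval].
  rewrite -SS (hermitian_ri (S v) _ hS).
  apply: bsum_cvg_ext h1 => e _; rewrite ri_rank1.
  apply: sqcoef_adjoint => [|x y]; first exact: hermitian_op_linear.
  exact: hermitian_ri.
move=> [A1 [A2 [f1 f2 ->]]].
by rewrite TrBl ?key ?fctE ?riDl ?riNl //; exact: fintr_htc.
Qed.

(* Uniformity in D is what makes Tr (A \o _) weakly continuous. *)
Lemma Tr_approx A (eps : R) : fintr b A -> 0 < eps ->
  exists (S : H -> H) (F : {fset H}), forall D, hermitian_op D ->
    (forall y, `|ri (D y) y| <= ri y y) ->
    `|Tr (A \o D) - bsum b (fun f => ri (D (S f)) (S f)) F| <= eps.
Proof.
move=> fA e0; have [S [_ _ fS h]] := Tr_sqrt fA.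
have h1 := hs_bsum fS.
have /cvgrPdist_le/(_ _ e0)[F _ /(_ F (fsubset_refl _)) hF] := h1.
exists S, F => D hD D1.
have h2 := h D hD.
have D2 e := D1 (S e).
(* As |<D y, y>| <= <y, y>, the sum and the difference of the two series have nonnegative terms; so
   the tail of Tr(A D) off F is dominated by that of the squared norm of S, whatever D is. *)
have := bsum_cvg_ub (g := fun f => ri (S f) (S f) - ri (D (S f)) (S f)) F _
  (bsum_cvgB h1 h2).
have := bsum_cvg_ub (g := fun f => ri (S f) (S f) + ri (D (S f)) (S f)) F _
  (bsum_cvgD h1 h2).
have -> : bsum b (fun f => ri (S f) (S f) + ri (D (S f)) (S f)) F =
  bsum b (fun f => ri (S f) (S f)) F + bsum b (fun f => ri (D (S f)) (S f)) F.
  by rewrite /bsum -big_split /=; apply: eq_bigr => e _; case: ifP;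
    rewrite ?addr0.
have -> : bsum b (fun f => ri (S f) (S f) - ri (D (S f)) (S f)) F =
  bsum b (fun f => ri (S f) (S f)) F - bsum b (fun f => ri (D (S f)) (S f)) F.
  rewrite /bsum -sumrB; apply: eq_bigr => e _; case: ifP; rewrite ?subr0 //.
have g1 e : b e -> 0 <= ri (S e) (S e) + ri (D (S e)) (S e).
  by move=> _; have := D2 e; rewrite ler_norml => /andP[]; lra.
have g2 e : b e -> 0 <= ri (S e) (S e) - ri (D (S e)) (S e).
  by move=> _; have := D2 e; rewrite ler_norml => /andP[]; lra.
move=> /(_ g1) k1 /(_ g2) k2.
move: hF; rewrite ler_norml => /andP[_ hF].
by rewrite ler_norml; apply/andP; split; move: k1 k2 hF; lra.
Qed.

Lemma cvg_bigsum (I : Type) (r : seq I) (P : pred I) (U : set_system nat)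
    (UF : Filter U) (F : I -> nat -> R) (l : I -> R) :
  (forall i, F i n @[n --> U] --> l i) ->
  \sum_(i <- r | P i) F i n @[n --> U] --> \sum_(i <- r | P i) l i.
Proof.
move=> h; elim: r => [|i r IH].
  rewrite big_nil; under eq_fun do rewrite big_nil; exact: cvg_cst.
rewrite big_cons; under eq_fun do rewrite big_cons.
by case: ifP => // _; apply: cvgD.
Qed.

Lemma Tr_weak_limit (U : set_system nat) (UF : ProperFilter U) A
    (Dn : nat -> H -> H) D : htc b A ->
    (forall n, hermitian_op (Dn n)) -> hermitian_op D ->
    (forall n y, `|ri (Dn n y) y| <= ri y y) ->
      (forall y, `|ri (D y) y| <= ri y y) ->
    (forall y, ri (Dn n y) y @[n --> U] --> ri (D y) y) ->
  Tr (A \o Dn n) @[n --> U] --> Tr (A \o D).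
Proof.
move=> hA hDn hD bDn bD hlim.
have key B : fintr b B -> Tr (B \o Dn n) @[n --> U] --> Tr (B \o D).
  move=> fB; apply/cvgrPdist_le => eps e0.
  have e3 : 0 < eps / 3 by rewrite divr_gt0.
  have [S [F hF]] := Tr_approx fB e3.
  have hs : bsum b (fun f => ri (Dn n (S f)) (S f)) F @[n --> U] -->
      bsum b (fun f => ri (D (S f)) (S f)) F.
    rewrite /bsum; apply: cvg_bigsum => f.
    by case: ifP => _; [exact: hlim|exact: cvg_cst].
  move/cvgrPdist_le : hs => /(_ _ e3); apply: filterS => n hn.
  have h1 := hF _ hD bD; have h2 := hF _ (hDn n) (bDn n).
  move: hn h1 h2; rewrite !ler_norml => /andP[? ?] /andP[? ?] /andP[? ?].
  by apply/andP; split; lra.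
case: hA => A1 [A2 [f1 f2 ->]].
rewrite TrBl //; try exact: fintr_htc.
have -> : (fun n => Tr ((A1 - A2) \o Dn n)) =
    (fun n => Tr (A1 \o Dn n) - Tr (A2 \o Dn n)).
  by apply/funext => n; rewrite TrBl //; exact: fintr_htc.
by apply: cvgB; exact: key.
Qed.
End TraceAlgebra.

(** * Differences of finite-trace psd operators are trace class *)

Section AbsoluteValue.
Context {R : realType} {H : hilbertType R} {b : set H}.
Hypothesis bO : orthonormal_basis b.
Implicit Types (x y z e v : H) (a : R) (c : R[i]) (A B D P Q S U V : H -> H).

(** Q x is the Riesz representer of <., x> on the kernel of V. *)
Lemma kernel_projection V : bounded_op V ->
  exists Q, [/\ hermitian_op Q, forall x, V (Q x) = 0 &
    forall v, V v = 0 -> Q v = v].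
Proof.
move=> /bounded_opP[lV [N N0 hN]].
have hQ x : exists z, V z = 0 /\ forall v, V v = 0 -> ri v z = ri v x.
  have [||||||z [zV hz]] := @riesz_real _ _ (fun v => V v = 0) (fun y =>
    ri y x) (nm x).
  - exact: linear0_op.
  - by move=> u v hu hv; rewrite (linearD_op _ _ lV) hu hv addr0.
  - by move=> a u hu; rewrite (linearZ_op _ _ lV) hu scaler0.
  - by move=> y y'; rewrite riE.
  - by move=> a y; rewrite riE.
  - by move=> y; rewrite mulrC ri_le.
  (* Riesz puts z only in the closure of the kernel; |V z| <= N |z - y| for y in the kernel shows V
     z = 0. *)
  exists z; split=> //; apply/eqP; rewrite -nm_eq0 eq_le nm_ge0 andbT.
  apply/ler_addgt0Pr => eps e0; rewrite add0r.
  have p : 0 < eps / (N + 1) by rewrite divr_gt0 // ltr_wpDl.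
  have [y hy zy] := zV _ p.
  have -> : V z = V (z - y) by rewrite (linearB_op _ _ lV) hy subr0.
  apply: le_trans (hN _) _; apply: (@le_trans _ _ ((N + 1) * (eps / (N + 1)))).
    by apply: ler_pM => //; [exact: nm_ge0|rewrite lerDl].
  by rewrite mulrCA mulfV ?mulr1 // gt_eqF // ltr_wpDl.
have [Q hQ'] := choice hQ.
have QV x : V (Q x) = 0 by case: (hQ' x).
have Qri x v : V v = 0 -> ri v (Q x) = ri v x by case: (hQ' x) => _; apply.
have uniq0 w : V w = 0 -> (forall v, V v = 0 -> ri v w = 0) -> w = 0.
  by move=> hw /(_ _ hw)/eqP; rewrite ri_eq0 => /eqP.
have lQ : linear Q.
  move=> c x y; apply/eqP; rewrite -subr_eq0; apply/eqP/uniq0.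
    by rewrite (linearB_op _ _ lV) lV !QV scaler0 addr0 subrr.
  move=> v hv; rewrite !riE opprD Qri // riDr (Qri y) //.
  have -> : ri v (c *: Q x) = ri v (c *: x); last by lra.
  have eZ u : ri v (c *: u) = ri (c^* *: v) u by rewrite riC ri_conjZ riC.
  by rewrite !eZ Qri // (linearZ_op _ _ lV) hv scaler0.
exists Q; split=> //.
  apply/hermitian_opP; split.
    apply/bounded_opP; split=> //; exists 1 => // x; rewrite mul1r.
    have := Qri x _ (QV x); rewrite ri_nm => h.
    have := ri_le (Q x) x; rewrite -h expr2.
    have [->|n0] := eqVneq (nm (Q x)) 0; first by rewrite nm_ge0.
    by rewrite ler_pM2l // lt_neqAle eq_sym n0 nm_ge0.
  move=> x y; transitivity (ri (Q x) (Q y)); first by rewrite (Qri _ _ (QV x)).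
  by rewrite riC (Qri _ _ (QV y)) riC.
move=> v hv; apply/eqP; rewrite -subr_eq0; apply/eqP/uniq0.
  by rewrite (linearB_op _ _ lV) QV hv subrr.
by move=> u hu; rewrite !riE Qri // subrr.
Qed.

(** The range of U lies in the kernel of V. With Q the projection onto that kernel, U = Q (U - V) Q
    <= Q B Q, a sandwich of finite trace. *)
Lemma fintr_positive_part U V B : psd_op U -> psd_op V -> fintr b B ->
    (forall x, V (U x) = 0) ->
    (forall x, ri (U x) x - ri (V x) x <= ri (B x) x) ->
  fintr b U.
Proof.
move=> pU pV fB VU hB; have hU := psd_op_hermitian pU.
have [Q [hQ VQ QV]] := kernel_projection (hermitian_op_bounded
  (psd_op_hermitian pV)).
apply: (fintr_le pU _ (fintr_sandwich bO fB hQ)) => x.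
have UQ y : U (Q y) = U y.
  apply: ri_ext => z.
  by rewrite (hermitian_ri _ _ hU) (hermitian_ri _ _ hQ) QV // (hermitian_ri _
    _ hU).
rewrite /= (hermitian_ri _ x hQ); apply: le_trans (hB (Q x)).
rewrite VQ ri0l subr0 UQ -[U x in leRHS]QV // (hermitian_ri _ _ hQ) .
have QQ : Q (Q x) = Q x by rewrite QV.
by rewrite QQ -(hermitian_ri _ _ hQ) QV.
Qed.

(** P = |A| commutes with A, so U = (P + A)/2 and V = (P - A)/2 satisfy U V = V U = (P^2 - A^2)/4 =
    0. From U - V = A <= A1 and V - U = -A <= A2 both have finite trace, hence so has P = U + V. *)
Lemma htc_trace_class A : htc b A -> trace_class A.
Proof.
move=> hA; have hh := htc_hermitian hA; have bA := hermitian_op_bounded hh.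
case: hA => A1 [A2 [f1 f2 eA]].
have [P [pP PP cP]] := psd_sqrt (psd_op_sq hh).
have hP := psd_op_hermitian pP; have lP := hermitian_op_linear hP.
have lA := hermitian_op_linear hh.
have PA x : P (A x) = A (P x) by apply: cP.
have PAri x : ri (P x) (P x) = ri (A x) (A x).
  by rewrite -(hermitian_ri (P x) _ hP) PP /= (hermitian_ri (A x) _ hh).
have half0 : (0 : R) <= 2^-1 by lra.
have le1 := psd_ge_of_sq pP hh PAri.
have le2 x : - ri (A x) x <= ri (P x) x.
  have := @psd_ge_of_sq _ _ P (- A) pP (hermitian_opN hh) _ x.
  by rewrite !fctE riNl; apply => y; rewrite !riE opprK PAri.
pose U := (2^-1)%:C *: (P + A); pose V := (2^-1)%:C *: (P - A).
have UE x : U x = (2^-1)%:C *: (P x + A x) by [].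
have VE x : V x = (2^-1)%:C *: (P x - A x) by [].
have pU : psd_op U.
  apply: psd_opZ => //; apply/psd_opP; split; first exact: hermitian_opD.
  by move=> x; have := le2 x; rewrite !fctE riDl; lra.
have pV : psd_op V.
  apply: psd_opZ => //; apply/psd_opP; split; first exact: hermitian_opB.
  by move=> x; have := le1 x; rewrite !fctE riDl riNl; lra.
have lU := hermitian_op_linear (psd_op_hermitian pU).
have lV := hermitian_op_linear (psd_op_hermitian pV).
have VU x : V (U x) = 0.
  rewrite UE (linearZ_op _ _ lV) VE (linearD_op _ _ lP) (linearD_op _ _ lA) PP.
  have -> : P (A x) = A (P x) by exact: PA.
  by apply: ri_ext => z; rewrite !riE /=; lra.
have UV x : U (V x) = 0.
  by apply: ri_ext => z; rewrite (hermitian_ri _ _ (psd_op_hermitian pU))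
     (hermitian_ri _ _ (psd_op_hermitian pV)) VU !riE.
have UVA x : ri (U x) x - ri (V x) x = ri (A1 x) x - ri (A2 x) x.
  have -> : ri (A1 x) x - ri (A2 x) x = ri (A x) x by rewrite eA !fctE !riE.
  by rewrite UE VE !riE; lra.
have fU : fintr b U.
  apply: fintr_positive_part pU pV f1 VU _ => x.
  by rewrite UVA; have := psd_op_ge0 x (fintr_psd f2); lra.
have fV : fintr b V.
  apply: fintr_positive_part pV pU f2 UV _ => x.
  by have := UVA x; have := psd_op_ge0 x (fintr_psd f1); lra.
have PUV : P = U + V.
  by apply/funext => x; apply: ri_ext => y; rewrite fctE UE VE !riE; lra.
split=> //; exists P, b; split=> //.
  split=> // x y; rewrite PP /=.
  by case: hh => _ ->.
by have := fintrD fU fV; rewrite -PUV => -[].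
Qed.
End AbsoluteValue.

(** * Weak compactness of decompositions *)

Section WeakCompactness.
Context {R : realType} {H : hilbertType R}.
Implicit Types (x y z e v : H) (a : R) (c : R[i]) (A B D E P Q S : H -> H).

(** A cluster point of an ultrafilter is a limit: a neighbourhood outside the ultrafilter would have
    its complement inside. *)
Lemma ultra_bounded_cvg (U : set_system nat) (UU : UltraFilter U) (u : nat -> R)
  (M : R) : (forall n, `|u n| <= M) -> cvg (u @ U).
Proof.
move=> uM; have UP : ProperFilter U by exact: ultra_proper.
have [|p [_ cp]] := @segment_compact R (- M) M (u @ U) _.
  have UI : U (u @^-1` [set` `[- M, M]]).
    by apply: filterS filterT => n _; rewrite /= in_itv /= -ler_norml.
  exact: UI.
apply/cvg_ex; exists p => O Op.
have [//|Un] := in_ultra_setVsetC (u @^-1` O) UU.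
have [r [/= nOr Or]] := cp (~` O) O Un Op.
by [].
Qed.

(** Each entry is bounded, so it converges along U; the limit form inherits the bound and is
    represented by Riesz. *)
Lemma weak_limit (U : set_system nat) (UU : UltraFilter U) (T : nat -> H -> H) :
    (forall n, linear (T n)) -> (forall n x, nm (T n x) <= nm x) ->
  exists B, bounded_op B /\
    forall x y, ri (T n x) y @[n --> U] --> ri (B x) y.
Proof.
move=> lT T1; have UP : ProperFilter U by exact: ultra_proper.
pose F x y := lim (ri (T n x) y @[n --> U]).
have bF n x y : `|ri (T n x) y| <= nm x * nm y.
  by apply: le_trans (ri_abs_le _ _) _; rewrite ler_wpM2r ?nm_ge0.
have hF x y : ri (T n x) y @[n --> U] --> F x y.
  exact: (ultra_bounded_cvg UU (fun n => bF n x y)).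
have eqF x y l : ri (T n x) y @[n --> U] --> l -> F x y = l.
  by move=> h; exact: cvg_lim.
have FD x y y' : F x (y + y') = F x y + F x y'.
  apply: eqF; under eq_fun do rewrite riDr. exact: cvgD.
have FZ x a y : F x (a%:C *: y) = a * F x y.
  by apply: eqF; under eq_fun do rewrite riZr; apply: cvgM => //;
    exact: cvg_cst.
have FM x y : F x y <= 1 * nm x * nm y.
  rewrite mul1r; apply: (cvgr_to_le (hF x y)); apply: nearW => n.
  exact: le_trans (ler_norm _) (bF _ _ _).
have [B hB] := riesz_op FD FZ FM.
exists B; split; last by move=> x y; rewrite hB.
apply/bounded_opP; split.
  move=> c x x'; apply: ri_ext => y.
  rewrite riDl ri_conjZ !hB; apply: eqF.
  under eq_fun do rewrite lT riDl ri_conjZ.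
  exact: cvgD.
exists 1 => // x; have := FM x (B x); rewrite -hB ri_nm !mul1r expr2.
have [->|n0] := eqVneq (nm (B x)) 0; first by rewrite nm_ge0.
by rewrite ler_pM2r // lt_neqAle eq_sym n0 nm_ge0.
Qed.

Lemma projection_idem E x : orth_projection E -> E (E x) = E x.
Proof. by move=> [_ EE]; rewrite -[RHS](congr1 (@^~ x) EE). Qed.

Lemma projection_ri E x : orth_projection E -> ri (E x) x = ri (E x) (E x).
Proof.
by move=> hE; rewrite -(hermitian_ri _ _ hE.1) projection_idem.
Qed.

Lemma projection_psd E : orth_projection E -> psd_op E.
Proof.
move=> hE; apply/psd_opP; split=> [|x]; first by case: hE.
by rewrite projection_ri // ri_ge0.
Qed.

Lemma projection_le E x : orth_projection E -> ri (E x) x <= ri x x.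
Proof.
move=> hE; have := ri_ge0 (x - E x); rewrite !riE (riC x (E x)).
by rewrite -(projection_ri x hE); lra.
Qed.

Section Decompositions.
Context {m : nat} {E : H -> H}.
Hypothesis hE : orth_projection E.
Implicit Types (Ds : 'I_m.+1 -> H -> H).

Lemma decomposition_hermitian Ds i : decomposition E Ds -> hermitian_op (Ds i).
Proof. by move=> [h _]; exact: psd_op_hermitian. Qed.

Lemma decomposition_sum Ds x y : decomposition E Ds ->
  \sum_i ri (Ds i x) y = ri (E x) y.
Proof. by move=> [_ <-]; rewrite fct_sumE ri_suml. Qed.

Lemma decomposition_le_proj Ds i x : decomposition E Ds ->
  ri (Ds i x) x <= ri (E x) x.
Proof.
move=> hD; rewrite -(decomposition_sum x x hD) (bigD1 i) //= lerDl.
by apply: sumr_ge0 => j _; apply: psd_op_ge0; exact: hD.1.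
Qed.

Lemma decomposition_le Ds i x : decomposition E Ds ->
  `|ri (Ds i x) x| <= ri x x.
Proof.
move=> hD; rewrite ger0_norm; last by apply: psd_op_ge0; exact: hD.1.
exact: le_trans (decomposition_le_proj _ _ hD) (projection_le _ hE).
Qed.

Lemma decomposition_norm Ds i x : decomposition E Ds -> nm (Ds i x) <= nm x.
Proof.
move=> hD; apply: nm_le_ri; first exact: nm_ge0.
have h y : ri (Ds i y) y <= 1 * ri y y.
  by rewrite mul1r (le_trans (ler_norm _)) // decomposition_le.
rewrite -ri_nm (le_trans (psd_op_norm_sq x (hD.1 i) h)) // mul1r.
by rewrite (le_trans (h x)) ?mul1r.
Qed.

(** For u = x - E x one has 0 <= <D_i u, u> <= <E u, u> = 0, so D_i u = 0. *)
Lemma decomposition_projr Ds i x : decomposition E Ds -> Ds i (E x) = Ds i x.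
Proof.
move=> hD; have lD := hermitian_op_linear (decomposition_hermitian i hD).
apply/esym/eqP; rewrite -subr_eq0 -(linearB_op _ _ lD); apply/eqP.
apply: (psd_op_ker (hD.1 i)); apply/eqP;
  rewrite eq_le (psd_op_ge0 _ (hD.1 i)) andbT.
apply: le_trans (decomposition_le_proj _ _ hD) _.
by rewrite (linearB_op _ _ (hermitian_op_linear hE.1)) projection_idem // subrr
  ri0l.
Qed.

(** Positivity and summing to E are conditions on matrix entries, so they survive the limit;
    [decomposition_norm] gives the uniform bound. *)
Lemma decomposition_weak_limit (U : set_system nat) (UU : UltraFilter U)
    (Dn : nat -> 'I_m.+1 -> H -> H) :
  (forall n, decomposition E (Dn n)) ->
  exists2 Ds, decomposition E Ds &
    forall i x, ri (Dn n i x) x @[n --> U] --> ri (Ds i x) x.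
Proof.
move=> hDn; have UP : ProperFilter U by exact: ultra_proper.
have lim i : exists B, bounded_op B /\
    forall x y, ri (Dn n i x) y @[n --> U] --> ri (B x) y.
  apply: weak_limit => [n|n x]; last exact: decomposition_norm.
  exact: hermitian_op_linear (decomposition_hermitian i (hDn n)).
have [Ds hDs] := choice lim.
exists Ds => [|i x]; last by case: (hDs i).
split=> [i|].
  have [bD cD] := hDs i; apply/psd_opP; split.
    apply/hermitian_opP; split=> // x y; rewrite [RHS]riC.
    have h : ri (Dn n i x) y @[n --> U] --> ri (Ds i y) x.
      under eq_fun do
        rewrite (hermitian_ri _ _ (decomposition_hermitian i (hDn _))) riC.
      exact: cD.
    exact: cvg_unique (cD x y) h.
  move=> x; apply: (cvgr_to_ge (cD x x)); apply: nearW => n.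
  by apply: psd_op_ge0; exact: (hDn n).1.
apply/funext => x; apply: ri_ext => y; rewrite fct_sumE ri_suml.
have h : \sum_i ri (Dn n i x) y @[n --> U] --> \sum_i ri (Ds i x) y.
  by apply: cvg_bigsum => i; case: (hDs i).
have h' : \sum_i ri (Dn n i x) y @[n --> U] --> ri (E x) y.
  under eq_fun do rewrite (decomposition_sum x y (hDn _)).
  exact: cvg_cst.
exact: cvg_unique h h'.
Qed.

End Decompositions.
End WeakCompactness.

(** * Variation and duality *)

Section Perturbation.
Context {R : realType} {H : hilbertType R}.
Implicit Types (x y z e v : H) (a : R) (c : R[i]) (A B D E P Q S L : H -> H).

(** Boundedness of phi is a consequence: otherwise a sequence with phi (u n) >= n would converge
    along U, which contains all tails. *)
Lemma attains_max (T : Type) (U : set_system nat) (UF : ProperFilter U)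
    (K : set T) (phi : T -> R) :
    \oo `<=` U -> K !=set0 ->
    (forall u : nat -> T, (forall n, K (u n)) ->
      exists2 p, K p & phi (u n) @[n --> U] --> phi p) ->
  exists2 p, K p & forall q, K q -> phi q <= phi p.
Proof.
move=> Uoo K0 hK; pose S := phi @` K.
have nS : S !=set0 by case: K0 => p Kp; exists (phi p), p.
have [hub|nub] := pselect (has_ubound S).
  have hS : has_sup S by [].
  have h n : exists p, K p /\ sup S - harmonic n <= phi p.
    have n0 : 0 < (n.+1%:R : R)^-1 by rewrite invr_gt0.
    have [_ [p Kp <-] hp] := sup_adherent n0 hS.
    by exists p; split => //; apply: ltW.
  have [u hu] := choice h.
  have [p Kp cp] := hK u (fun n => (hu n).1).
  exists p => // q Kq; apply: (@le_trans _ _ (sup S)).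
    by apply: ub_le_sup => //; exists q.
  have ch : sup S - harmonic n @[n --> U] --> sup S - 0.
    apply: cvgB; first exact: cvg_cst.
    by apply: cvg_trans (@cvg_harmonic R); move=> O /Uoo.
  rewrite subr0 in ch.
  by apply: (ler_cvg_to ch cp); apply: nearW => n; case: (hu n).
have h (n : nat) : exists p, K p /\ n%:R <= phi p.
  apply: contrapT => hn; apply: nub; exists n%:R => _ [p Kp <-].
  by rewrite leNgt; apply/negP => /ltW hp; apply: hn; exists p.
have [u hu] := choice h.
have [p Kp cp] := hK u (fun n => (hu n).1).
exfalso.
have h1 : U [set n | phi (u n) <= phi p + 1].
  have /cvgrPdist_le/(_ 1 ltr01) := cp.
  by apply: filterS => n /=; rewrite ler_norml => /andP[? ?]; lra.
have h2 : U [set n | phi p + 2 <= n%:R].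
  by apply: Uoo; exact: nbhs_infty_ger.
have [n [/= n1 n2]] := filter_ex (filterI h1 h2).
by have := (hu n).2; lra.
Qed.

(** A first-order test with quadratic error. The range eps N <= 2 is that of admissible variations:
    it keeps 2 eps - eps^2 N nonnegative, and N = 2 means eps <= 1. *)
Lemma small_eps_le0 (a c N : R) : 0 <= N ->
  (forall eps, 0 < eps -> eps * N <= 2 -> 2 * eps * a <= eps ^+ 2 * c) ->
  a <= 0.
Proof.
move=> N0 h; rewrite leNgt; apply/negP => a0.
(* At t = 2 a / d the summand a N gives t N <= 2, and [|c| + 1] makes d > c, while the hypothesis
   divided by t reads d <= c. *)
pose d := `|c| + 1 + a * N.
have aN : 0 <= a * N by rewrite mulr_ge0 // ltW.
have d0 : 0 < d by rewrite /d; have := normr_ge0 c; lra.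
have e0 : 0 < 2 * a / d by rewrite divr_gt0 // mulr_gt0.
have eN : 2 * a / d * N <= 2.
  rewrite mulrAC ler_pdivrMr // /d; have := normr_ge0 c; lra.
have := h _ e0 eN; set t := 2 * a / d in e0 *.
have td : t * d = 2 * a by rewrite /t mulfVK // gt_eqF.
have -> : 2 * t * a = t * (t * d) by rewrite td; ring.
have -> : t ^+ 2 * c = t * (t * c) by ring.
rewrite !ler_pM2l // /d; have := ler_norm c; lra.
Qed.

Section Variation.
Variables (D : H -> H) (v : H) (eps : R).
Hypothesis hD : hermitian_op D.

Definition rank1_shift x := x - eps%:C *: rank1 v x.

Lemma rank1_shift_hermitian : hermitian_op rank1_shift.
Proof.
have hv := psd_op_hermitian (rank1_psd v).
exact: (hermitian_opB (@hermitian_op_id _ H) (hermitian_opZ eps hv)).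
Qed.

(** With P = |v><v|: P D P = <D v, v> P, and P D + D P is half the difference of the rank-one
    operators of v + D v and v - D v. The trace of the variation then follows from [Tr_rank1]. *)
Lemma rank1_shift_sandwich :
  rank1_shift \o D \o rank1_shift =
  D - (eps / 2)%:C *: (rank1 (v + D v) - rank1 (v - D v)) +
    (eps ^+ 2 * ri (D v) v)%:C *: rank1 v.
Proof.
have lD := hermitian_op_linear hD.
have hT := rank1_shift_hermitian.
apply/funext => x; apply: ri_ext => z.
have sE y : rank1_shift y = y - eps%:C *: rank1 v y by [].
have h0 := hermitian_im0 v hD.
have h1 y : ri (D y) v = ri y (D v) by exact: hermitian_ri.
have h2 y : ri (D y) ('i *: v) = ri y ('i *: D v).
  by rewrite (hermitian_ri _ _ hD) (linearZ_op _ _ lD).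
have hv y : ri (D (rank1 v x)) y = ri x v * ri y (D v) + ri x ('i *:
  v) * ri y ('i *: D v).
  by rewrite (hermitian_ri _ _ hD) ri_rank1E !h1 !h2.
transitivity (ri (D (rank1_shift x)) (rank1_shift z)).
  by rewrite [LHS](hermitian_ri _ _ hT).
rewrite !sE (linearB_op _ _ lD) (linearZ_op _ _ lD).
transitivity (ri (D x) z - (eps / 2) * (ri (rank1 (v + D v) x) z - ri (rank1 (v
  - D v) x) z)
   + (eps ^+ 2 * ri (D v) v) * ri (rank1 v x) z); last first.
  by rewrite !fctE !riE.
have s1 : ri (rank1 v z) (D v) = ri z v * ri (D v) v.
  by rewrite ri_rank1E h0 mulr0 addr0.
have s2 : ri (rank1 v z) ('i *: D v) = ri z ('i *: v) * ri (D v) v.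
  by rewrite ri_rank1E ri_il h0 ri_ii; ring.
have s3 : ri (D x) (rank1 v z) =
    ri z v * ri x (D v) + ri z ('i *: v) * ri x ('i *: D v).
  by rewrite riC ri_rank1E h1 h2.
rewrite !riE !hv s1 s2 s3 !ri_rank1E !scalerDr !scalerN !riE.
by field.
Qed.
End Variation.
End Perturbation.

(** * Existence of optimal operators, weak and strong duality *)

Section StrongDuality.
Context {R : realType} {H : hilbertType R} {b : set H} {m : nat} {E : H -> H}.
Hypothesis bO : orthonormal_basis b.
Hypothesis hE : orth_projection E.
Variable Rs : 'I_m.+1 -> H -> H.
Hypothesis hRs : forall i, htc b (Rs i).
Hypothesis RsE : forall i, Rs i \o E = Rs i.
Implicit Types (x y z e v : H) (a : R) (c : R[i]) (A B P Q S L : H -> H).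
Implicit Types (D : 'I_m.+1 -> H -> H).

Lemma primal_value_cvg (U : set_system nat) (UU : UltraFilter U)
    (Dn : nat -> 'I_m.+1 -> H -> H) :
  (forall n, decomposition E (Dn n)) ->
  exists2 D, decomposition E D &
    forall i A, htc b A -> Tr (A \o Dn n i) @[n --> U] --> Tr (A \o D i).
Proof.
move=> hDn; have [D hD cD] := decomposition_weak_limit hE UU hDn.
exists D => // i A hA; apply: (Tr_weak_limit bO (@ultra_proper _ _ UU) hA).
- by move=> n; exact: decomposition_hermitian.
- exact: decomposition_hermitian hD.
- by move=> n y; exact: (decomposition_le hE _ _ (hDn n)).
- by move=> y; exact: (decomposition_le hE _ _ hD).
- exact: cD.
Qed.

Lemma decomposition_exists : exists D, decomposition E D.
Proof.
exists (fun i => if i == ord0 then E else 0); split=> [i|].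
  by case: eqP => _; [exact: projection_psd|exact: psd_op0].
by rewrite big_ord_recl /= big1 ?addr0.
Qed.

Lemma optimal_exists : exists2 D, decomposition E D &
  forall D', decomposition E D' -> primal_value Rs D' <= primal_value Rs D.
Proof.
have [U [UU Uoo]] := ultraFilterLemma (@eventually_filter).
have UP : ProperFilter U by exact: ultra_proper.
apply: (attains_max (K := decomposition E) (phi := primal_value Rs) UP Uoo).
  exact: decomposition_exists.
move=> Dn hDn; have [D hD cD] := primal_value_cvg UU hDn.
by exists D => //; rewrite /primal_value; apply: cvg_bigsum => i; exact: cD.
Qed.

Lemma Rs_hermitian i : hermitian_op (Rs i).
Proof. exact: htc_hermitian (hRs i). Qed.

Lemma Rs_projr i x : Rs i (E x) = Rs i x.
Proof. exact: (congr1 (@^~ x) (RsE i)). Qed.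

(** In (i) and (ii) L is only given as trace class; L = (L - R_0) + R_0 shows that it is
    Hermitian. *)
Lemma ge_op_htc_hermitian L : (forall i, ge_op L (Rs i)) -> hermitian_op L.
Proof.
move=> /(_ ord0)/psd_op_hermitian h; rewrite -(subrK (Rs ord0) L).
exact: hermitian_opD h (Rs_hermitian ord0).
Qed.

Lemma duality_gap L D : htc b L -> decomposition E D ->
  Tr (L \o E) - primal_value Rs D = \sum_i Tr ((L - Rs i) \o D i).
Proof.
move=> hL hD; have hDi i := decomposition_hermitian i hD.
rewrite -{1}hD.2 (Tr_sumr bO) // -sumrB; apply: eq_bigr => i _.
by rewrite (TrBl bO).
Qed.

Lemma duality_gap_ge0 L D i : htc b L -> ge_op L (Rs i) ->
  decomposition E D -> 0 <= Tr ((L - Rs i) \o D i).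
Proof. by move=> hL geL hD; apply: (Tr_ge0 bO);
  [exact: htcB| |exact: hD.1]. Qed.

Lemma weak_duality L D : htc b L -> (forall i, ge_op L (Rs i)) ->
  decomposition E D -> primal_value Rs D <= Tr (L \o E).
Proof.
move=> hL geL hD; rewrite -subr_ge0 duality_gap //.
by apply: sumr_ge0 => i _; exact: duality_gap_ge0.
Qed.

Lemma duality_slackness L D : htc b L -> (forall i, ge_op L (Rs i)) ->
  decomposition E D ->
  (Tr (L \o E) = primal_value Rs D <-> forall i, (L - Rs i) \o D i = 0).
Proof.
move=> hL geL hD; have gap := duality_gap hL hD; split=> [h i|h].
  apply: (Tr_eq0 bO); [exact: htcB|exact: geL|exact: hD.1|].
  move: gap; rewrite h subrr => /esym/eqP; rewrite psumr_eq0.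
    by move=> /allP/(_ i); rewrite mem_index_enum => /(_ isT)/eqP.
  by move=> j _; exact: duality_gap_ge0.
apply/eqP; rewrite -subr_eq0 gap big1 // => i _.
by rewrite h; exact: (Tr0l bO hermitian_op_id).
Qed.

(* The variation replaces D_i by (1 - eps |v><v|) D_i (1 - eps |v><v|) and
   gives the part of E lost in this way to the index j. *)
Lemma optimal_variation D j v : decomposition E D ->
    (forall D', decomposition E D' ->
      primal_value Rs D' <= primal_value Rs D) ->
    E v = v ->
  ri (Rs j v) v <= \sum_i ri (Rs i v) (D i v).
Proof.
move=> hD opt Ev; rewrite -subr_le0.
pose N := ri v v; pose w i := D i v.
have hDi i := decomposition_hermitian i hD.
have hr u := psd_op_hermitian (@rank1_psd R H u).
have hr' u : hermitian_op (@rank1 R H u) := hr u.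
pose cc := N * ri (Rs j v) v - \sum_i ri (D i v) v * ri (Rs i v) v.
apply: (@small_eps_le0 R _ cc N (ri_ge0 v)) => eps e0 eN.
(* As E v = v, the part of E lost is E - (1 - eps P) E (1 - eps P) = k P, which is psd because eps N
   <= 2. *)
pose k := 2 * eps - eps ^+ 2 * N.
have k0 : 0 <= k.
  by rewrite /k expr2 -mulrA mulrCA (mulrC 2) -mulrBr mulr_ge0 ?(ltW e0)
    ?subr_ge0.
pose T := rank1_shift v eps.
have hT : hermitian_op T := rank1_shift_hermitian v eps.
pose G i := (T \o D i \o T) + (if i == j then k%:C *: rank1 v else 0).
have hG : decomposition E G.
  split=> [i|].
    apply: psd_opD; first by apply: psd_op_sandwich => //; exact: hD.1.
    case: eqP => _; last exact: psd_op0.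
    by apply: psd_opZ => //; exact: rank1_psd.
  apply/funext => x; apply: ri_ext => y; rewrite fct_sumE ri_suml.
  transitivity (ri ((T \o E \o T) x) y + k * ri (rank1 v x) y).
    transitivity (\sum_i (ri ((T \o D i \o T) x) y +
        (if i == j then k * ri (rank1 v x) y else 0))).
      by apply: eq_bigr => i _; rewrite /G; case: ifP => _; rewrite !fctE !riE.
    rewrite big_split /= -big_mkcond /= big_pred1_eq; congr (_ + _).
    rewrite (hermitian_ri _ _ hT) -(decomposition_sum _ _ hD).
    by apply: eq_bigr => i _; rewrite (hermitian_ri _ _ hT).
  rewrite rank1_shift_sandwich; last exact: hE.1.
  rewrite Ev !fctE !riE !ri_rank1E !scalerDr !scalerN !riE.
  by rewrite /k /N; field.
have hTD i : hermitian_op (T \o D i \o T) by exact: hermitian_op_sandwich.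
have := opt _ hG.
have TrT i : Tr (Rs i \o (T \o D i \o T)) = Tr (Rs i \o D i) -
    2 * eps * ri (Rs i v) (D i v) + eps ^+ 2 * (ri (D i v) v * ri (Rs i v) v).
  rewrite rank1_shift_sandwich //.
  have h1 : hermitian_op ((eps / 2)%:C *:
    (rank1 (v + D i v) - rank1 (v - D i v))).
    by apply/hermitian_opZ/hermitian_opB.
  have h2 : hermitian_op ((eps ^+ 2 * ri (D i v) v)%:C *: rank1 v).
    exact/hermitian_opZ.
  rewrite (TrDr bO) // ?(TrBr bO) //; last exact: hermitian_opB.
  rewrite !(TrZr bO) //; last exact: hermitian_opB.
  rewrite (TrBr bO) // !(Tr_rank1 bO) //.
  have lR := hermitian_op_linear (Rs_hermitian i).
  rewrite (linearB_op _ _ lR) (linearD_op _ _ lR) !riE.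
  rewrite (hermitian_ri (D i v) v (Rs_hermitian i)) (riC (D i v) (Rs i v)).
  by field.
have -> : primal_value Rs G = primal_value Rs D +
    (\sum_i eps ^+ 2 * (ri (D i v) v * ri (Rs i v) v)
     - \sum_i 2 * eps * ri (Rs i v) (D i v)) + k * ri (Rs j v) v.
  rewrite /primal_value -sumrB -big_split /=.
  have -> : k * ri (Rs j v) v = \sum_i (if i == j then k * ri (Rs j v) v else
    0).
    by rewrite -big_mkcond /= big_pred1_eq.
  rewrite -big_split /=; apply: eq_bigr => i _.
  rewrite /G; case: eqP => [->|_].
    rewrite (TrDr bO) ?(TrZr bO) ?(Tr_rank1 bO) //; last exact: hermitian_opZ.
    by rewrite TrT; ring.
  by rewrite addr0 TrT; ring.
rewrite -!mulr_sumr /cc /k -/N mulrBr; lra.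
Qed.

(** Symmetrising does not change Re <R_i D_i x, x>, so L is Hermitian and still has the quadratic
    form that [optimal_variation] bounds from below. *)
Lemma optimal_dual D : decomposition E D ->
    (forall D', decomposition E D' ->
      primal_value Rs D' <= primal_value Rs D) ->
  exists L, [/\ htc b L, forall i, ge_op L (Rs i) &
    Tr (L \o E) = primal_value Rs D].
Proof.
move=> hD opt; have hDi i := decomposition_hermitian i hD.
have hRi := Rs_hermitian.
pose L := (2^-1)%:C *: \sum_i ((Rs i \o D i) + (D i \o Rs i)).
have LE x y : ri (L x) y =
    2^-1 * \sum_i (ri (Rs i (D i x)) y + ri (D i (Rs i x)) y).
  rewrite /L fctE riZl fct_sumE ri_suml; congr (_ * _).
  by apply: eq_bigr => i _; rewrite !fctE riDl.
have hL : htc b L.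
  by apply: htcZ => //; apply: htc_sum => i; exact: htc_anticomm.
have hLh := htc_hermitian hL.
have LEx x : ri (L x) x = \sum_i ri (Rs i x) (D i x).
  rewrite LE mulr_sumr; apply: eq_bigr => i _.
  rewrite (hermitian_ri (D i x) x (hRi i)) (hermitian_ri (Rs i x) x (hDi i)).
  by rewrite (riC (D i x)); lra.
exists L; split=> //.
- move=> j; apply/ge_opP; split; first exact: hermitian_opB.
  (* The variation reaches only vectors E x; since R_i E = R_i and D_i E = D_i, both quadratic forms
     agree at x and E x. *)
  move=> x; have := optimal_variation j hD opt (projection_idem x hE).
  rewrite LEx Rs_projr (hermitian_ri _ _ (hRi j)) Rs_projr -(hermitian_ri _ _
    (hRi j)).
  move=> h; apply: le_trans h _; rewrite le_eqVlt; apply/orP; left; apply/eqP.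
  by apply: eq_bigr => i _; rewrite Rs_projr (decomposition_projr hE).
have c1 := Tr_cvg bO hL hE.1.
have c2 : bsum_cvg b (fun e => \sum_i ri (Rs i (D i e)) e) (primal_value Rs D).
  by apply: bsum_cvg_sum => i; exact: (Tr_cvg bO).
apply: bsum_cvg_unique c1 _; apply: bsum_cvg_ext c2 => e _.
rewrite LE mulr_sumr; apply: eq_bigr => i _.
rewrite (decomposition_projr hE) // Rs_projr (hermitian_ri (Rs i e) _ (hDi i)).
by rewrite (hermitian_ri e _ (hRi i)) (riC e); lra.
Qed.

End StrongDuality.

(** * Lagrange multipliers *)

Section LagrangeMultipliers.
Context {R : realType}.

Definition pospart (x : R) : R := (`|x| + x) / 2.

Lemma pospart_ge0 x : 0 <= pospart x.
Proof. by rewrite /pospart; have := ler_norm (- x); rewrite normrN; lra. Qed.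

Lemma pospart_ge x : x <= pospart x.
Proof. by rewrite /pospart; have := ler_norm x; lra. Qed.

Lemma pospart_mul x : pospart x * x = pospart x ^+ 2.
Proof.
rewrite /pospart; have [x0|x0] := leP 0 x.
  by rewrite ger0_norm //; field.
by rewrite ltr0_norm //; field.
Qed.

(** The squared positive part has derivative 2 x^+, and this is its first-order expansion with error
    at most d^2: if x - d > 0 then x - d <= x^+ - d. *)
Lemma pospart_sqrB (x d : R) :
  pospart (x - d) ^+ 2 <= pospart x ^+ 2 - 2 * pospart x * d + d ^+ 2.
Proof.
have -> : pospart x ^+ 2 - 2 * pospart x * d + d ^+ 2 = (pospart x - d) ^+ 2.
  by ring.
rewrite /pospart; have [h|h] := leP 0 (x - d); have [k|k] := leP 0 x;
  rewrite ?(ger0_norm h) ?(ltr0_norm h) ?(ger0_norm k) ?(ltr0_norm k); nra.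
Qed.

(* Quadratic penalty: the maximisers p_n of f - n/2 sum_i ((eps_i - g_i)^+)^2
   maximise f + sum_i l_n,i g_i with l_n,i = n (eps_i - g_i p_n)^+, and Slater's
   condition bounds the l_n,i; a limit point gives the multipliers. *)
Lemma lagrange_multipliers (T : Type) (I : finType) (U : set_system nat)
    (UU : UltraFilter U) (K : set T) (f : T -> R) (g : I -> T ->
      R) (eps : I -> R) :
    \oo `<=` U ->
    (forall p q t, K p -> K q -> 0 < t -> t <= 1 -> exists r, [/\ K r,
      f r = f p + t * (f q - f p) & forall i, g i r = g i p + t * (g i q - g i
        p)]) ->
    (forall u : nat -> T, (forall n, K (u n)) -> exists p, [/\ K p,
      f (u n) @[n --> U] --> f p & forall i, g i (u n) @[n --> U] --> g i p]) ->
    (exists2 s, K s & forall i, eps i < g i s) ->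
  exists lambda p, [/\ forall i, 0 <= lambda i, K p,
    forall q, K q -> f q + \sum_i lambda i * g i q <= f p + \sum_i lambda i * g
      i p,
    forall i, lambda i * (eps i - g i p) = 0 & forall i, eps i <= g i p].
Proof.
move=> Uoo Kconv Kcpt [s Ks Ss];
  have UP : ProperFilter U by exact: ultra_proper.
have K0 : K !=set0 by exists s.
have [pM KpM hM] : exists2 p, K p & forall q, K q -> f q <= f p.
  apply: (attains_max UP Uoo K0) => u Ku.
  by have [p [Kp cf _]] := Kcpt u Ku; exists p.
pose nn n : R := n.+1%:R.
have nn0 n : 0 < nn n by rewrite /nn ltr0n.
pose phi n p := f p - nn n / 2 * \sum_i pospart (eps i - g i p) ^+ 2.
have hp n : exists p, K p /\ forall q, K q -> phi n q <= phi n p.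
  suff [p Kp hp] : exists2 p, K p & forall q, K q ->
    phi n q <= phi n p by exists p.
  apply: (attains_max UP Uoo K0) => u Ku.
  have [p [Kp cf cg]] := Kcpt u Ku; exists p => //.
  apply: cvgB => //; apply: cvgM; first exact: cvg_cst.
  apply: cvg_bigsum => i; rewrite /pospart.
  have ca : eps i - g i (u k) @[k --> U] --> eps i - g i p.
    by apply: cvgB => //; exact: cvg_cst.
  under eq_fun do rewrite expr2; rewrite expr2.
  suff cp : (`|eps i - g i (u k)| + (eps i - g i (u k))) / 2 @[k --> U] -->
      (`|eps i - g i p| + (eps i - g i p)) / 2 by apply: cvgM.
  by apply: cvgM; [apply: cvgD => //; exact: cvg_norm|exact: cvg_cst].
have [p hp'] := choice hp.
pose a n i := eps i - g i (p n).
pose lam n i := nn n * pospart (a n i).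
have lam0 n i : 0 <= lam n i by rewrite mulr_ge0 ?pospart_ge0 ?ltW.
have first_order n q : K q ->
    f q - f (p n) + \sum_i lam n i * (g i q - g i (p n)) <= 0.
  move=> Kq; have [Kp hpn] := hp' n.
  (* Moving from p_n a fraction t <= 1 towards q stays in K, whence N = 2; maximality of p_n is then
     read to first order in t. *)
  apply: (@small_eps_le0 R _ (nn n * \sum_i (g i q - g i (p n)) ^+ 2) 2) =>
    // t t0 t1.
  have t1' : t <= 1 by lra.
  have [r [Kr fr gr]] := Kconv _ _ _ Kp Kq t0 t1'.
  have := hpn _ Kr; rewrite /phi fr.
  have : \sum_i pospart (eps i - g i r) ^+ 2 <=
     \sum_i pospart (a n i) ^+ 2 -
     2 * t * \sum_i pospart (a n i) * (g i q - g i (p n)) +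
     t ^+ 2 * \sum_i (g i q - g i (p n)) ^+ 2.
    rewrite !mulr_sumr -sumrB -big_split /=; apply: ler_sum => i _.
    rewrite gr (_ : eps i - _ = a n i - t * (g i q - g i (p n))); last first.
      by rewrite /a; ring.
    by apply: le_trans (pospart_sqrB _ _) _; rewrite exprMn; lra.
  have -> : \sum_i lam n i * (g i q - g i (p n)) =
      nn n * \sum_i pospart (a n i) * (g i q - g i (p n)).
    by rewrite mulr_sumr; apply: eq_bigr => i _; rewrite /lam mulrA.
  set s1 := \sum_i pospart (eps i - g i r) ^+ 2.
  rewrite -/(a n _); set s2 := \sum_i pospart (a n i) ^+ 2.
  set s3 := \sum_i pospart (a n i) * _; set s4 := \sum_i (_ ^+ 2).
  move=> h1 h2; have := ler_wpM2l (ltW (nn0 n)) h1; nra.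
(* The first-order condition at the Slater point s bounds the sum of lam_j (g_j s - eps_j) by f p_n
   - f s <= f pM - f s; all its terms are nonnegative, so each one obeys this bound. *)
pose B i := (f pM - f s) / (g i s - eps i).
have gs0 i : 0 < g i s - eps i by rewrite subr_gt0.
have lamB n i : lam n i <= B i.
  rewrite ler_pdivlMr //.
  have h1 := first_order n s Ks; have h2 := hM _ (hp' n).1.
  have h3 : \sum_j lam n j * (g j s - eps j) <= \sum_j lam n j * (g j s - g j
    (p n)).
    apply: ler_sum => j _.
    rewrite (_ : g j s - g j (p n) = g j s - eps j + a n j);
      last by rewrite /a; ring.
    by rewrite [leRHS]mulrDr lerDl /lam -mulrA pospart_mul mulr_ge0 ?sqr_ge0
      ?ltW.
  have : lam n i * (g i s - eps i) <= \sum_j lam n j * (g j s - eps j).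
    rewrite (bigD1 i) //= lerDl; apply: sumr_ge0 => j _.
    by rewrite mulr_ge0 ?lam0 // ltW.
  lra.
have clam i : cvg (lam n i @[n --> U]).
  apply: (@ultra_bounded_cvg _ U UU _ (B i)) => n.
  by rewrite ger0_norm ?lam0 ?lamB.
pose l i := lim (lam n i @[n --> U]).
have cl i : lam n i @[n --> U] --> l i by exact: clam.
have [q [Kq cf cg]] := Kcpt p (fun n => (hp' n).1).
have l0 i : 0 <= l i by apply: (cvgr_to_ge (cl i)); apply: nearW => n.
have ca i : a n i @[n --> U] --> eps i - g i q.
  by apply: cvgB => //; exact: cvg_cst.
have charm (c : R) : c * harmonic n @[n --> U] --> 0.
  rewrite -[0](mulr0 c); apply: cvgM; first exact: cvg_cst.
  by apply: cvg_trans (@cvg_harmonic R); move=> O /Uoo.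
(* The violation is lam / (n + 1) with lam bounded, so it tends to 0: the limit point is feasible,
   and lam a = lam a^+ tends to 0 as well. *)
have aB n i : pospart (a n i) <= B i * harmonic n.
  by rewrite /harmonic /= ler_pdivlMr ?ltr0n // mulrC lamB.
have lama n i : lam n i * a n i = lam n i * pospart (a n i).
  by rewrite /lam -[LHS]mulrA pospart_mul expr2 mulrA.
exists l, q; split=> //.
- move=> r Kr; rewrite -subr_le0.
  have c : f r - f (p n) + \sum_i lam n i * (g i r - g i (p n)) @[n --> U] -->
      f r - f q + \sum_i l i * (g i r - g i q).
    apply: cvgD; first by apply: cvgB => //; exact: cvg_cst.
    by apply: cvg_bigsum => i; apply: cvgM => //; apply: cvgB => //;
      exact: cvg_cst.
  have : f r - f q + \sum_i l i * (g i r - g i q) <= 0.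
    by apply: (cvgr_to_le c); apply: nearW => n; exact: first_order.
  under eq_bigr do rewrite mulrBr.
  by rewrite sumrB; lra.
- move=> i; apply/eqP; rewrite eq_le; apply/andP; split.
    apply: (ler_cvg_to (cvgM (cl i) (ca i)) (charm (B i * B i))).
    apply: nearW => n; rewrite /= lama -mulrA.
    by apply: ler_pM => //; exact: pospart_ge0.
  apply: (cvgr_to_ge (cvgM (cl i) (ca i))); apply: nearW => n.
  by rewrite /= lama mulr_ge0 ?pospart_ge0.
- move=> i; rewrite -subr_le0; apply: (ler_cvg_to (ca i) (charm (B i))).
  by apply: nearW => n; exact: le_trans (pospart_ge _) (aB n i).
Qed.
End LagrangeMultipliers.

(** * Optimality conditions for the supremum and the infimum *)

Section ExtendedValues.
Context {R : realType} {H : hilbertType R} {b : set H} {m : nat} {E : H -> H}.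
Hypothesis bO : orthonormal_basis b.
Hypothesis hE : orth_projection E.
Variable Rs : 'I_m.+1 -> H -> H.
Hypothesis hRs : forall i, htc b (Rs i).
Hypothesis RsE : forall i, Rs i \o E = Rs i.
Implicit Types (L : H -> H) (D : 'I_m.+1 -> H -> H).

Definition optimal D := forall D', decomposition E D' ->
  primal_value Rs D' <= primal_value Rs D.

Lemma primal_sup_optimal D : decomposition E D ->
  (primal_value Rs D)%:E = primal_sup E Rs <-> optimal D.
Proof.
move=> hD; split=> [h D' hD'|h].
  by rewrite -lee_fin h; apply: ereal_sup_ubound; exists D'.
apply/eqP; rewrite eq_le; apply/andP; split.
  by apply: ereal_sup_ubound; exists D.
by apply: ge_ereal_sup => _ [D' hD' <-]; rewrite lee_fin; exact: h.
Qed.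

Lemma dual_inf_optimal D : decomposition E D -> optimal D ->
  dual_inf E Rs = (primal_value Rs D)%:E.
Proof.
move=> hD h; apply/eqP; rewrite eq_le; apply/andP; split.
  have [L [hL geL <-]] := optimal_dual bO hE hRs RsE hD h.
  apply: ereal_inf_lbound; exists L => //; split=> //.
    exact: htc_hermitian hL.
  exact: htc_trace_class hL.
apply: le_ereal_inf_tmp => _ [L [hL tL geL] <-]; rewrite lee_fin.
by apply: (weak_duality bO) => //; exact: trace_class_htc.
Qed.

Lemma strong_duality : primal_sup E Rs = dual_inf E Rs.
Proof.
have [D hD opt] := optimal_exists bO hE hRs.
by rewrite (dual_inf_optimal hD opt); apply/esym/primal_sup_optimal.
Qed.

Lemma trace_class_ge_htc L : trace_class L -> (forall i, ge_op L (Rs i)) ->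
  htc b L.
Proof.
move=> tL geL; apply: trace_class_htc => //.
exact: (ge_op_htc_hermitian hRs).
Qed.

Lemma primal_optimality D : decomposition E D ->
  (primal_value Rs D)%:E = primal_sup E Rs <->
  exists L, [/\ trace_class L, forall i, ge_op L (Rs i) &
    forall i, (L - Rs i) \o D i = 0].
Proof.
move=> hD; rewrite primal_sup_optimal //; split=> [opt|[L [tL geL sl]]].
  have [L [hL geL TL]] := optimal_dual bO hE hRs RsE hD opt.
  exists L; split=> //; first exact: htc_trace_class hL.
  exact/(duality_slackness bO hRs hL geL hD).
have hL := trace_class_ge_htc tL geL.
move=> D' hD'; rewrite -(duality_slackness bO hRs hL geL hD).2 //.
exact: (weak_duality bO).
Qed.

Lemma dual_optimality L : trace_class L -> (forall i, ge_op L (Rs i)) ->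
  (Tr (L \o E))%:E = dual_inf E Rs <->
  exists D, decomposition E D /\ forall i, (L - Rs i) \o D i = 0.
Proof.
move=> tL geL; have hL := trace_class_ge_htc tL geL; split.
  have [D hD opt] := optimal_exists bO hE hRs.
  rewrite (dual_inf_optimal hD opt) => -[TL]; exists D; split=> //.
  exact/(duality_slackness bO hRs hL geL hD).
move=> [D [hD sl]]; have TL := (duality_slackness bO hRs hL geL hD).2 sl.
rewrite (dual_inf_optimal hD) ?TL //.
apply/(primal_sup_optimal hD)/(primal_optimality hD).
by exists L.
Qed.
End ExtendedValues.

(** * The constrained problem in Lagrange form *)

Section Constrained.
Context {R : realType} {H : hilbertType R} {b : set H} {m : nat} {E : H -> H}.
Hypothesis bO : orthonormal_basis b.
Hypothesis hE : orth_projection E.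
Variables (C : 'I_m -> H -> H) (eps : 'I_m -> R).
Hypothesis hC : forall j, htc b (C j).
Hypothesis CE : forall j, C j \o E = C j.
Implicit Types (L : H -> H) (lambda : 'I_m -> R).

Lemma R_lambda_htc lambda i : htc b (R_lambda C lambda i).
Proof.
rewrite /R_lambda; case: unliftP => [j _|_]; first exact: htcZ.
exact: htc_sum.
Qed.

Lemma R_lambda_proj lambda i : R_lambda C lambda i \o E = R_lambda C lambda i.
Proof.
have CEx j x : C j (E x) = C j x by exact: (congr1 (@^~ x) (CE j)).
apply/funext => x; rewrite /R_lambda /=; case: unliftP => [j _|_].
  by rewrite !fctE CEx.
by rewrite !fct_sumE; apply: eq_bigr => j _; rewrite CEx.
Qed.

Lemma R_lambda_value lambda (D : 'I_m.+1 -> H -> H) : decomposition E D ->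
  primal_value (R_lambda C lambda) D =
  Tr ((\sum_j C j) \o D ord0) + \sum_j Tr (C j \o D (lift ord0 j)) +
    \sum_j lambda j * Tr (C j \o D (lift ord0 j)).
Proof.
move=> hD; rewrite /primal_value big_ord_recl /R_lambda unlift_none -addrA.
congr (_ + _); rewrite -big_split /=; apply: eq_bigr => j _.
have hDj := decomposition_hermitian (lift ord0 j) hD.
by rewrite liftK (TrZl bO) //; ring.
Qed.

(** The operators D_k with k >= 1, k <> i, sum to E - D_0 - D_i. So the cost is a constant minus
    Tr((sum of C_j) D_0) minus the sum of Tr(C_j D_j), which explains the choice of R_0; the
    multiplier terms are added and subtracted. *)
Lemma constrained_valueE lambda (D : 'I_m.+1 -> H -> H) : decomposition E D ->
  constrained_value C (fun j => D (lift ord0 j)) =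
  \sum_j Tr (C j \o E) - primal_value (R_lambda C lambda) D +
    \sum_j lambda j * Tr (C j \o D (lift ord0 j)).
Proof.
move=> hD; have hDi i := decomposition_hermitian i hD.
rewrite R_lambda_value // /constrained_value (Tr_suml bO) //.
rewrite opprD addrA subrK opprD addrA -!sumrB; apply: eq_bigr => j _.
rewrite -{1}hD.2 big_ord_recl (TrDr bO) //; last first.
  by apply: hermitian_op_sum => k _.
rewrite [in RHS](bigD1 j) //= (TrDr bO) //; last first.
  by apply: hermitian_op_sum => k _.
by ring.
Qed.

Definition complete_decomposition (D : 'I_m -> H -> H) (i : 'I_m.+1) : H -> H :=
  if unlift ord0 i is Some j then D j else E - \sum_j D j.

Lemma complete_decomposition_lift D j :
  complete_decomposition D (lift ord0 j) = D j.
Proof. by rewrite /complete_decomposition liftK. Qed.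

Lemma complete_decompositionP (D : 'I_m -> H -> H) :
  (forall i, psd_op (D i)) -> ge_op E (\sum_i D i) ->
  decomposition E (complete_decomposition D).
Proof.
move=> pD gD; split=> [i|].
  by rewrite /complete_decomposition; case: unliftP.
rewrite big_ord_recl (eq_bigr D) => [|j _].
  by rewrite /complete_decomposition unlift_none subrK.
exact: complete_decomposition_lift.
Qed.

Lemma decomposition_ge (D : 'I_m.+1 -> H -> H) : decomposition E D ->
  ge_op E (\sum_j D (lift ord0 j)).
Proof.
move=> hD; rewrite /ge_op -{1}hD.2 big_ord_recl addrK; exact: hD.1.
Qed.

(** For any feasible D', lambda_j Tr(C_j D'_j) >= lambda_j eps_j and the primal value is at most
    Tr(L E). For the given D both are equalities, by slackness and strong duality. *)
Lemma lagrange_solution_value lambda (D : 'I_m.+1 -> H -> H) L :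
  lagrange_solution E C eps lambda D L ->
  constrained_inf E C eps =
    (\sum_j (Tr (C j \o E) + lambda j * eps j) - Tr (L \o E))%:E.
Proof.
move=> [lam0 [hD Dopt] [hL tL geL Lopt] slack feas].
have hR := R_lambda_htc lambda.
have hLt : htc b L by exact: trace_class_htc.
have TL : Tr (L \o E) = primal_value (R_lambda C lambda) D.
  by apply: EFin_inj; rewrite Lopt Dopt (strong_duality bO hE hR (R_lambda_proj
    lambda)).
apply/eqP; rewrite eq_le; apply/andP; split.
  apply: ereal_inf_lbound; exists (fun j => D (lift ord0 j)).
    by split=> // [i|]; [exact: hD.1|exact: decomposition_ge].
  rewrite (constrained_valueE lambda hD) TL big_split /=; congr (_%:E).
  rewrite addrAC; congr (_ + _ - _); apply: eq_bigr => j _.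
  by apply/esym/eqP; rewrite -subr_eq0 -mulrBr slack.
apply: le_ereal_inf_tmp => _ [D' [pD' gD' fD'] <-]; rewrite lee_fin.
have hG := complete_decompositionP pD' gD'.
have := constrained_valueE lambda hG.
rewrite (_ : (fun j => _) = D'); last first.
  by apply/funext => j; rewrite complete_decomposition_lift.
move=> ->; rewrite big_split /= addrAC lerD //; last first.
  by apply: ler_sum => j _; rewrite complete_decomposition_lift ler_wpM2l.
by rewrite lerB // (weak_duality bO).
Qed.

Lemma decomposition_convex (D D' : 'I_m.+1 -> H -> H) (t : R) :
  decomposition E D -> decomposition E D' -> 0 < t -> t <= 1 ->
  decomposition E (fun i => D i + t%:C *: (D' i - D i)).
Proof.
move=> [pD sD] [pD' sD'] t0 t1; split=> [i|].
  have -> : D i + t%:C *: (D' i - D i) = (1 - t)%:C *: D i + t%:C *: D' i.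
    apply/funext => x; apply: ri_ext => y; rewrite !fctE !riE; ring.
  by apply: psd_opD; apply: psd_opZ; rewrite ?subr_ge0 // ltW.
by rewrite big_split /= -scaler_sumr sumrB sD sD' subrr scaler0 addr0.
Qed.

Lemma lagrange_solution_exists : strictly_feasible E C eps ->
  exists lambda (D : 'I_m.+1 -> H -> H) L, lagrange_solution E C eps lambda D L.
Proof.
move=> [S [pS gS hS]].
have [U [UU Uoo]] := ultraFilterLemma (@eventually_filter).
(* f is the primal value at lambda = 0, a constant minus the cost; adding the sum of lambda_j g_j
   gives the primal value for [R_lambda], so the multipliers make D optimal for it. *)
pose f (D : 'I_m.+1 -> H -> H) :=
  Tr ((\sum_j C j) \o D ord0) + \sum_j Tr (C j \o D (lift ord0 j)).
pose g j (D : 'I_m.+1 -> H -> H) := Tr (C j \o D (lift ord0 j)).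
have hsC : htc b (\sum_j C j) by exact: htc_sum.
have [D D' t hD hD' t0 t1|u hu||lambda [D [lam0 hD opt slack feas]]] :=
    @lagrange_multipliers R _ _ U UU (decomposition E) f g eps Uoo.
- exists (fun i => D i + t%:C *: (D' i - D i)).
  have hDi i := decomposition_hermitian i hD.
  have hDi' i := decomposition_hermitian i hD'.
  have lin A i : htc b A -> Tr (A \o (D i + t%:C *: (D' i - D i))) =
      Tr (A \o D i) + t * (Tr (A \o D' i) - Tr (A \o D i)).
    move=> hA; have hB := hermitian_opB (hDi' i) (hDi i).
    rewrite (TrDr bO) ?(TrZr bO) ?(TrBr bO) //; exact: hermitian_opZ.
  split; [exact: decomposition_convex| |by move=> j; exact: lin].
  rewrite /f lin // (eq_bigr _ (fun j _ => lin (C j) (lift ord0 j) (hC j))).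
  by rewrite big_split /= -mulr_sumr sumrB; ring.
- have [D hD cD] := primal_value_cvg bO hE UU hu.
  exists D; split=> // [|j]; last exact: cD.
  have UP : ProperFilter U by exact: ultra_proper.
  by apply: cvgD; [exact: cD|apply: cvg_bigsum => j; exact: cD].
- exists (complete_decomposition S); first exact: complete_decompositionP.
  by move=> j; rewrite /g complete_decomposition_lift.
have optD : optimal (E := E) (R_lambda C lambda) D.
  by move=> D' hD'; rewrite !R_lambda_value //; exact: opt.
have hR := R_lambda_htc lambda; have hRE := R_lambda_proj lambda.
have [L [hL geL TL]] := optimal_dual bO hE hR hRE hD optD.
exists lambda, D, L; split=> //.
  by split=> //; apply/primal_sup_optimal.
split=> //; first exact: htc_hermitian hL.
  exact: htc_trace_class hL.
by rewrite TL (dual_inf_optimal bO hE hR hRE hD optD).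
Qed.
End Constrained.

Theorem theorem5 (R : realType) (H : hilbertType R) (m : nat) (hm : (0 < m)%N)
    (Rs : 'I_m.+1 -> H -> H) (E : H -> H)
    (hRherm : forall i, hermitian_op (Rs i))
    (hRtc : forall i, trace_class (Rs i))
    (hE : orth_projection E)
    (hRE : forall i, Rs i \o E = Rs i) :
  [/\
    (* (i) *)
    (forall D : 'I_m.+1 -> H -> H, decomposition E D ->
       ((primal_value Rs D)%:E = primal_sup E Rs <->
        exists L : H -> H,
          [/\ trace_class L, forall i, ge_op L (Rs i) &
              forall i, (L - Rs i) \o D i = 0])),
    (* (ii) *)
    (forall L : H -> H, trace_class L -> (forall i, ge_op L (Rs i)) ->
       ((Tr (L \o E))%:E = dual_inf E Rs <->
        exists D : 'I_m.+1 -> H -> H,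
          decomposition E D /\ forall i, (L - Rs i) \o D i = 0)),
    primal_sup E Rs = dual_inf E Rs &
    (* (iii) *)
    forall (C : 'I_m -> H -> H) (eps : 'I_m -> R),
      (forall j, hermitian_op (C j)) ->
      (forall j, trace_class (C j)) ->
      (forall j, C j \o E = C j) ->
      (forall (lambda : 'I_m -> R) (D : 'I_m.+1 -> H -> H) (L : H -> H),
         lagrange_solution E C eps lambda D L ->
         constrained_inf E C eps =
           (\sum_j (Tr (C j \o E) + lambda j * eps j) - Tr (L \o E))%:E) /\
      (strictly_feasible E C eps ->
       exists (lambda : 'I_m -> R) (D : 'I_m.+1 -> H -> H) (L : H -> H),
         lagrange_solution E C eps lambda D L)].
Proof.
(* The orthonormal basis used throughout is the one contained in the trace class hypothesis on
   R_0. *)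
have [_ [_ [b [_ bO _]]]] := hRtc ord0.
have hRs i : htc b (Rs i) by exact: trace_class_htc.
split.
- exact: (primal_optimality bO hE hRs hRE).
- exact: (dual_optimality bO hE hRs hRE).
- exact: (strong_duality bO hE hRs hRE).
move=> C eps hCh hCt hCE.
have hC j : htc b (C j) by exact: trace_class_htc.
split; first exact: (lagrange_solution_value bO hE hC hCE).
exact: (lagrange_solution_exists bO hE hC hCE).
Qed.
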